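(* For every $\lambda\in\mathfrak{h}^*$, the annihilator in $U$ of the Verma module $\Delta(\lambda)$ is centrally generated, that is, $\mathrm{Ann}_U\Delta(\lambda)=U\,\mathrm{Ann}_{Z(\mathfrak{s})}\Delta(\lambda)$.
   Context: The Schrödinger algebra $\mathfrak{s}$ is the complex Lie algebra with basis $e,h,f,p,q,z$, with $z$ central and the remaining brackets $[h,e]=2e$, $[e,f]=h$, $[h,f]=-2f$, $[e,q]=p$, $[e,p]=0$, $[h,p]=p$, $[f,p]=q$, $[f,q]=0$, $[h,q]=-q$, $[p,q]=z$. Put $U=U(\mathfrak{s})$, with center $Z(\mathfrak{s})$, $\mathfrak{h}=\mathbb{C}h\oplus\mathbb{C}z$, $\mathfrak{n}_+=\mathbb{C}e\oplus\mathbb{C}p$, $\mathfrak{b}=\mathfrak{h}\oplus\mathfrak{n}_+$. The Verma module is $\Delta(\lambda)=U\otimes_{U(\mathfrak{b})}\mathbb{C}_\lambda$, where $\mathfrak{n}_+$ acts on the one-dimensional module $\mathbb{C}_\lambda$ by $0$ and $\mathfrak{h}$ acts via $\lambda$. $\mathrm{Ann}_{Z(\mathfrak{s})}\Delta(\lambda)$ denotes the set of elements of $Z(\mathfrak{s})$ acting by zero on $\Delta(\lambda)$. *)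

(* Defs.v *)
From HB Require Import structures.
From mathcomp Require Import all_boot all_order all_algebra.
From mathcomp Require Import boolp classical_sets reals complex ring.

Set Implicit Arguments.
Unset Strict Implicit.
Unset Printing Implicit Defensive.

Import GRing.Theory.
Local Open Scope quotient_scope.
Local Open Scope ring_scope.

HB.mixin Record Lmodule_isLieAlgebra (K : fieldType) L of GRing.Lmodule K L := {
  lie : L -> L -> L;
  lie_linearl : forall (y : L) (k : K) (x x' : L),
    lie (k *: x + x') y = k *: lie x y + lie x' y;
  lie_linearr : forall (x : L) (k : K) (y y' : L),
    lie x (k *: y + y') = k *: lie x y + lie x y';
  liexx : forall x : L, lie x x = 0;
  lie_jacobi : forall x y z : L,
    lie x (lie y z) + lie y (lie z x) + lie z (lie x y) = 0
}.

#[short(type="lieAlgType")]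
HB.structure Definition LieAlgebra (K : fieldType) :=
  {L of Lmodule_isLieAlgebra K L & GRing.Lmodule K L}.

(* f is a Lie algebra map into an associative algebra with its commutator. *)
Definition lie_to_assoc (K : fieldType) (L : lieAlgType K) (A : algType K)
    (f : L -> A) : Prop :=
  forall x y, f (lie x y) = f x * f y - f y * f x.

(* U(L) is presented as the unital associative K-algebra generated by the
   vectors of L, subject to the linear relations of L and to
   xy - yx = [x, y]: formal expressions modulo the least congruence [ueq]
   containing the K-algebra axioms and these relations. This relation is not
   decidable, hence the classical [gen_eqMixin] and [asbool] used to form the
   quotient. *)
Section Enveloping.
Variables (K : fieldType) (L : lieAlgType K).

Inductive uterm : Type :=
| UGen of L
| UCst of K
| UAdd of uterm & uterm
| UMul of uterm & uterm.

Inductive ueq : uterm -> uterm -> Prop :=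
| ueq_refl a : ueq a a
| ueq_sym a b : ueq a b -> ueq b a
| ueq_trans b a c : ueq a b -> ueq b c -> ueq a c
| ueq_add a a' b b' : ueq a a' -> ueq b b' -> ueq (UAdd a b) (UAdd a' b')
| ueq_mul a a' b b' : ueq a a' -> ueq b b' -> ueq (UMul a b) (UMul a' b')
| ueq_addA a b c : ueq (UAdd a (UAdd b c)) (UAdd (UAdd a b) c)
| ueq_addC a b : ueq (UAdd a b) (UAdd b a)
| ueq_add0 a : ueq (UAdd (UCst 0) a) a
| ueq_addN a : ueq (UAdd (UMul (UCst (-1)) a) a) (UCst 0)
| ueq_mulA a b c : ueq (UMul a (UMul b c)) (UMul (UMul a b) c)
| ueq_mul1l a : ueq (UMul (UCst 1) a) a
| ueq_mul1r a : ueq (UMul a (UCst 1)) a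
| ueq_mulDl a b c : ueq (UMul (UAdd a b) c) (UAdd (UMul a c) (UMul b c))
| ueq_mulDr a b c : ueq (UMul a (UAdd b c)) (UAdd (UMul a b) (UMul a c))
| ueq_cstD k l : ueq (UCst (k + l)) (UAdd (UCst k) (UCst l))
| ueq_cstM k l : ueq (UCst (k * l)) (UMul (UCst k) (UCst l))
| ueq_cstC k a : ueq (UMul (UCst k) a) (UMul a (UCst k))
| ueq_genD x y : ueq (UGen (x + y)) (UAdd (UGen x) (UGen y))
| ueq_genZ k x : ueq (UGen (k *: x)) (UMul (UCst k) (UGen x))
| ueq_lie x y : ueq (UGen (lie x y))
    (UAdd (UMul (UGen x) (UGen y))
          (UMul (UCst (-1)) (UMul (UGen y) (UGen x)))).

HB.instance Definition _ := gen_eqMixin uterm.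
HB.instance Definition _ := gen_choiceMixin uterm.

Definition ueqb (a b : uterm) : bool := `[< ueq a b >].

Lemma ueqb_equiv : equiv_class_of ueqb.
Proof.
split.
- by move=> a; apply/asboolP; apply: ueq_refl.
- by move=> a b; apply/asboolP/asboolP => h; apply: ueq_sym.
- by move=> b a c /asboolP ab /asboolP bc; apply/asboolP; apply: ueq_trans bc.
Qed.

Canonical ueqb_rel := EquivRelPack ueqb_equiv.

Definition enveloping : Type := {eq_quot ueqb_rel}.

Definition upi (a : uterm) : enveloping := \pi_{eq_quot ueqb_rel} a.
Definition urepr (u : enveloping) : uterm := @repr uterm {eq_quot ueqb_rel} u.

Lemma ureprK u : upi (urepr u) = u. Proof. exact: reprK. Qed.

Lemma upiP a b : upi a = upi b <-> ueq a b.
Proof. by split=> [/eqmodP/asboolP//|h]; apply/eqmodP/asboolP. Qed.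

Lemma upi_eq a b : ueq a b -> upi a = upi b.
Proof. by move/upiP. Qed.

Lemma urepr_pi a : ueq (urepr (upi a)) a.
Proof. by apply/upiP; rewrite ureprK. Qed.

Definition uzero : enveloping := upi (UCst 0).
Definition uone : enveloping := upi (UCst 1).
Definition uadd (u v : enveloping) := upi (UAdd (urepr u) (urepr v)).
Definition umul (u v : enveloping) := upi (UMul (urepr u) (urepr v)).
Definition uopp (u : enveloping) := upi (UMul (UCst (-1)) (urepr u)).
Definition uscale (k : K) (u : enveloping) := upi (UMul (UCst k) (urepr u)).
Definition ugen (x : L) : enveloping := upi (UGen x).

Lemma uaddE a b : uadd (upi a) (upi b) = upi (UAdd a b).
Proof. by apply/upi_eq/ueq_add; apply: urepr_pi. Qed.

Lemma umulE a b : umul (upi a) (upi b) = upi (UMul a b).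
Proof. by apply/upi_eq/ueq_mul; apply: urepr_pi. Qed.

Lemma uoppE a : uopp (upi a) = upi (UMul (UCst (-1)) a).
Proof. by apply/upi_eq/ueq_mul; [apply: ueq_refl|apply: urepr_pi]. Qed.

Lemma uscaleE k a : uscale k (upi a) = upi (UMul (UCst k) a).
Proof. by apply/upi_eq/ueq_mul; [apply: ueq_refl|apply: urepr_pi]. Qed.

Let uE := (uaddE, umulE, uoppE, uscaleE).

Fixpoint ueval (A : algType K) (f : L -> A) (a : uterm) : A :=
  match a with
  | UGen x => f x
  | UCst k => k%:A
  | UAdd a b => ueval f a + ueval f b
  | UMul a b => ueval f a * ueval f b
  end.

Lemma ueval_ueq (A : algType K) (f : {linear L -> A}) : lie_to_assoc f ->
  forall a b, ueq a b -> ueval f a = ueval f b.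
Proof.
move=> fB a b; elim=> //=.
- by move=> ? ? ? _ -> _ ->.
- by move=> ? ? ? ? _ -> _ ->.
- by move=> ? ? ? ? _ -> _ ->.
- by move=> *; rewrite addrA.
- by move=> *; rewrite addrC.
- by move=> *; rewrite scale0r add0r.
- by move=> *; rewrite scaleN1r mulN1r addNr scale0r.
- by move=> *; rewrite mulrA.
- by move=> *; rewrite scale1r mul1r.
- by move=> *; rewrite scale1r mulr1.
- by move=> *; rewrite mulrDl.
- by move=> *; rewrite mulrDr.
- by move=> *; rewrite scalerDl.
- by move=> *; rewrite -scalerAl mul1r scalerA.
- by move=> *; rewrite -scalerAl mul1r -scalerAr mulr1.
- by move=> *; rewrite linearD.
- by move=> *; rewrite linearZ -scalerAl mul1r.
- by move=> x y; rewrite fB scaleN1r mulN1r.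
Qed.

HB.instance Definition _ := Choice.on enveloping.

Fact uaddA : associative uadd.
Proof.
move=> u v w; rewrite -[u]ureprK -[v]ureprK -[w]ureprK !uE.
by apply/upi_eq/ueq_addA.
Qed.

Fact uaddC : commutative uadd.
Proof.
by move=> u v; rewrite -[u]ureprK -[v]ureprK !uE; apply/upi_eq/ueq_addC.
Qed.

Fact uadd0 : left_id uzero uadd.
Proof. by move=> u; rewrite -[u]ureprK !uE; apply/upi_eq/ueq_add0. Qed.

Fact uaddN : left_inverse uzero uopp uadd.
Proof. by move=> u; rewrite -[u]ureprK !uE; apply/upi_eq/ueq_addN. Qed.

HB.instance Definition _ :=
  GRing.isZmodule.Build enveloping uaddA uaddC uadd0 uaddN.

Fact umulA : associative umul.
Proof.
move=> u v w; rewrite -[u]ureprK -[v]ureprK -[w]ureprK !uE.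
by apply/upi_eq/ueq_mulA.
Qed.

Fact umul1l : left_id uone umul.
Proof. by move=> u; rewrite -[u]ureprK !uE; apply/upi_eq/ueq_mul1l. Qed.

Fact umul1r : right_id uone umul.
Proof. by move=> u; rewrite -[u]ureprK !uE; apply/upi_eq/ueq_mul1r. Qed.

Fact umulDl : left_distributive umul uadd.
Proof.
move=> u v w; rewrite -[u]ureprK -[v]ureprK -[w]ureprK !uE.
by apply/upi_eq/ueq_mulDl.
Qed.

Fact umulDr : right_distributive umul uadd.
Proof.
move=> u v w; rewrite -[u]ureprK -[v]ureprK -[w]ureprK !uE.
by apply/upi_eq/ueq_mulDr.
Qed.

Fact uone_neq0 : uone != uzero.
Proof.
apply/eqP => /upiP.
have zB : lie_to_assoc (\0 : L -> K^o) by move=> x y /=; rewrite mulr0 subrr.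
move/(ueval_ueq (f := (\0 : {linear L -> K^o})) zB) => /= /eqP.
by rewrite scale0r scale1r oner_eq0.
Qed.

HB.instance Definition _ := GRing.Zmodule_isNzRing.Build enveloping
  umulA umul1l umul1r umulDl umulDr uone_neq0.

Fact uscaleA a b v : uscale a (uscale b v) = uscale (a * b) v.
Proof.
rewrite -[v]ureprK !uE; apply: upi_eq; apply: ueq_trans (ueq_mulA _ _ _) _.
by apply: ueq_mul; [apply: ueq_sym; apply: ueq_cstM|apply: ueq_refl].
Qed.

Fact uscale1 : left_id 1 uscale.
Proof. by move=> u; rewrite -[u]ureprK !uE; apply/upi_eq/ueq_mul1l. Qed.

Fact uscaleDr : right_distributive uscale +%R.
Proof.
move=> k u v; rewrite -[u]ureprK -[v]ureprK.
by rewrite /GRing.add /= !uE; apply/upi_eq/ueq_mulDr.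
Qed.

Fact uscaleDl v : {morph uscale^~ v : a b / a + b}.
Proof.
move=> a b; rewrite -[v]ureprK /GRing.add /= !uE; apply: upi_eq.
apply: ueq_trans (ueq_mulDl _ _ _).
by apply: ueq_mul; [apply: ueq_cstD|apply: ueq_refl].
Qed.

HB.instance Definition _ := GRing.Zmodule_isLmodule.Build K enveloping
  uscaleA uscale1 uscaleDr uscaleDl.

Fact uscaleAl (k : K) (u v : enveloping) : k *: (u * v) = (k *: u) * v.
Proof.
rewrite -[u]ureprK -[v]ureprK /GRing.scale /GRing.mul /= !uE.
by apply/upi_eq/ueq_mulA.
Qed.

HB.instance Definition _ := GRing.Lmodule_isLalgebra.Build K enveloping uscaleAl.

Fact uscaleAr (k : K) (u v : enveloping) : k *: (u * v) = u * (k *: v).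
Proof.
rewrite -[u]ureprK -[v]ureprK /GRing.scale /GRing.mul /= !uE; apply: upi_eq.
apply: ueq_trans (ueq_mulA _ _ _) _; apply: ueq_trans (ueq_sym (ueq_mulA _ _ _)).
by apply: ueq_mul; [apply: ueq_cstC|apply: ueq_refl].
Qed.

HB.instance Definition _ := GRing.Lalgebra_isAlgebra.Build K enveloping uscaleAr.

Fact ugen_linear : linear ugen.
Proof.
move=> k x y; rewrite /GRing.scale /GRing.add /= /ugen !uE; apply: upi_eq.
apply: ueq_trans (ueq_genD _ _) _.
by apply: ueq_add; [apply: ueq_genZ|apply: ueq_refl].
Qed.

HB.instance Definition _ :=
  GRing.isLinear.Build K L enveloping _ ugen ugen_linear.

Lemma ugen_lie : lie_to_assoc ugen.
Proof.
move=> x y; rewrite /GRing.add /GRing.opp /GRing.mul /= /ugen !uE.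
by apply/upi_eq/ueq_lie.
Qed.

Section UniversalProperty.
Variables (A : algType K) (f : {linear L -> A}) (fB : lie_to_assoc f).

Definition ulift of lie_to_assoc f := fun u : enveloping => ueval f (urepr u).

Lemma uliftE a : ulift fB (upi a) = ueval f a.
Proof. by apply: ueval_ueq => //; apply: urepr_pi. Qed.

Lemma ulift_gen x : ulift fB (ugen x) = f x.
Proof. exact: uliftE. Qed.

Fact ulift_linear : linear (ulift fB).
Proof.
move=> k u v; rewrite -[u]ureprK -[v]ureprK.
by rewrite /GRing.scale /GRing.add /= !uE !uliftE /= -scalerAl mul1r.
Qed.

Fact ulift_monoid : monoid_morphism (ulift fB).
Proof.
split; first by rewrite /GRing.one /= uliftE /= scale1r.
move=> u v; rewrite -[u]ureprK -[v]ureprK.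
by rewrite [in LHS]/GRing.mul /= !uE !uliftE.
Qed.

HB.instance Definition _ :=
  GRing.isLinear.Build K enveloping A _ (ulift fB) ulift_linear.
HB.instance Definition _ :=
  GRing.isMonoidMorphism.Build enveloping A (ulift fB) ulift_monoid.

Lemma ulift_unique (g : {lrmorphism enveloping -> A}) :
  (forall x, g (ugen x) = f x) -> g =1 ulift fB.
Proof.
move=> gf u; rewrite -[u]ureprK uliftE; elim: (urepr u) => /=.
- exact: gf.
- move=> k; rewrite -(rmorph1 g) -linearZ; congr (g _).
  rewrite [RHS]/GRing.scale [in RHS]/GRing.one /= uE.
  by apply/upi_eq/ueq_sym/ueq_mul1r.
- move=> a ea b eb; rewrite -ea -eb -rmorphD; congr (g _).
  by rewrite [RHS]/GRing.add /= uE.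
- move=> a ea b eb; rewrite -ea -eb -rmorphM; congr (g _).
  by rewrite [RHS]/GRing.mul /= uE.
Qed.

End UniversalProperty.
End Enveloping.

(* The tensor product R (x)_S N, where R is a right S-module through
   phi : S -> R: the abelian group generated by the symbols r (x) n subject to
   biadditivity and r phi(s) (x) n = r (x) s n; R acts on the left factor. *)
Section TensorProduct.
Variables (S R : nzRingType) (phi : {rmorphism S -> R}) (N : lmodType S).

Inductive tterm : Type :=
| TTen of R & N
| TZero
| TOpp of tterm
| TAdd of tterm & tterm.

Inductive teq : tterm -> tterm -> Prop :=
| teq_refl a : teq a a
| teq_sym a b : teq a b -> teq b a
| teq_trans b a c : teq a b -> teq b c -> teq a c
| teq_opp a a' : teq a a' -> teq (TOpp a) (TOpp a')
| teq_add a a' b b' : teq a a' -> teq b b' -> teq (TAdd a b) (TAdd a' b')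
| teq_addA a b c : teq (TAdd a (TAdd b c)) (TAdd (TAdd a b) c)
| teq_addC a b : teq (TAdd a b) (TAdd b a)
| teq_add0 a : teq (TAdd TZero a) a
| teq_addN a : teq (TAdd (TOpp a) a) TZero
| teq_tenDl r r' n : teq (TTen (r + r') n) (TAdd (TTen r n) (TTen r' n))
| teq_tenDr r n n' : teq (TTen r (n + n')) (TAdd (TTen r n) (TTen r n'))
| teq_tenS r s n : teq (TTen (r * phi s) n) (TTen r (s *: n)).

HB.instance Definition _ := gen_eqMixin tterm.
HB.instance Definition _ := gen_choiceMixin tterm.

Definition teqb (a b : tterm) : bool := `[< teq a b >].

Lemma teqb_equiv : equiv_class_of teqb.
Proof.
split.
- by move=> a; apply/asboolP; apply: teq_refl.
- by move=> a b; apply/asboolP/asboolP => h; apply: teq_sym.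
- by move=> b a c /asboolP ab /asboolP bc; apply/asboolP; apply: teq_trans bc.
Qed.

Canonical teqb_rel := EquivRelPack teqb_equiv.

Definition tensor : Type := {eq_quot teqb_rel}.

Definition tpi (a : tterm) : tensor := \pi_{eq_quot teqb_rel} a.
Definition trepr (u : tensor) : tterm := @repr tterm {eq_quot teqb_rel} u.

Lemma treprK u : tpi (trepr u) = u. Proof. exact: reprK. Qed.

Lemma tpiP a b : tpi a = tpi b <-> teq a b.
Proof. by split=> [/eqmodP/asboolP//|h]; apply/eqmodP/asboolP. Qed.

Lemma tpi_eq a b : teq a b -> tpi a = tpi b.
Proof. by move/tpiP. Qed.

Lemma trepr_pi a : teq (trepr (tpi a)) a.
Proof. by apply/tpiP; rewrite treprK. Qed.

Fixpoint tact (r : R) (a : tterm) : tterm :=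
  match a with
  | TTen r' n => TTen (r * r') n
  | TZero => TZero
  | TOpp a => TOpp (tact r a)
  | TAdd a b => TAdd (tact r a) (tact r b)
  end.

Lemma tact_teq r a b : teq a b -> teq (tact r a) (tact r b).
Proof.
elim=> /=; try by move=> *; constructor.
- by move=> {}b {}a c _ ab _ bc; apply: teq_trans ab bc.
- by move=> r1 r2 n; rewrite mulrDr; apply: teq_tenDl.
- by move=> r1 s n; rewrite mulrA; apply: teq_tenS.
Qed.

Definition tzero : tensor := tpi TZero.
Definition topp (u : tensor) := tpi (TOpp (trepr u)).
Definition tadd (u v : tensor) := tpi (TAdd (trepr u) (trepr v)).
Definition tscale (r : R) (u : tensor) := tpi (tact r (trepr u)).

Lemma toppE a : topp (tpi a) = tpi (TOpp a).
Proof. by apply/tpi_eq/teq_opp; apply: trepr_pi. Qed.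

Lemma taddE a b : tadd (tpi a) (tpi b) = tpi (TAdd a b).
Proof. by apply/tpi_eq/teq_add; apply: trepr_pi. Qed.

Lemma tscaleE r a : tscale r (tpi a) = tpi (tact r a).
Proof. by apply/tpi_eq/tact_teq; apply: trepr_pi. Qed.

Let tE := (taddE, toppE, tscaleE).

HB.instance Definition _ := Choice.on tensor.

Fact taddA : associative tadd.
Proof.
move=> u v w; rewrite -[u]treprK -[v]treprK -[w]treprK !tE.
by apply/tpi_eq/teq_addA.
Qed.

Fact taddC : commutative tadd.
Proof.
by move=> u v; rewrite -[u]treprK -[v]treprK !tE; apply/tpi_eq/teq_addC.
Qed.

Fact tadd0 : left_id tzero tadd.
Proof. by move=> u; rewrite -[u]treprK !tE; apply/tpi_eq/teq_add0. Qed.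

Fact taddN : left_inverse tzero topp tadd.
Proof. by move=> u; rewrite -[u]treprK !tE; apply/tpi_eq/teq_addN. Qed.

HB.instance Definition _ :=
  GRing.isZmodule.Build tensor taddA taddC tadd0 taddN.

Definition pure_tensor (r : R) (n : N) : tensor := tpi (TTen r n).

Fact tscaleA r s u : tscale r (tscale s u) = tscale (r * s) u.
Proof.
rewrite -[u]treprK !tE; congr tpi.
by elim: (trepr u) => //= [r' n|a ->|a -> b ->] //; rewrite mulrA.
Qed.

Fact tscale1 : left_id 1 tscale.
Proof.
move=> u; rewrite -[u]treprK !tE; congr tpi.
by elim: (trepr u) => //= [r' n|a ->|a -> b ->] //; rewrite mul1r.
Qed.

Fact tscaleDr : right_distributive tscale +%R.
Proof.
by move=> r u v; rewrite -[u]treprK -[v]treprK /GRing.add /= !tE.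
Qed.

Fact tscaleDl u : {morph tscale^~ u : r s / r + s}.
Proof.
move=> r s; rewrite -[u]treprK !tE.
have opE a : tpi (TOpp a) = - tpi a by rewrite -toppE.
have addE a b : tpi (TAdd a b) = tpi a + tpi b by rewrite -taddE.
elim: (trepr u) => [r' n||a IH|a IHa b IHb] /=.
- by rewrite mulrDl -addE; apply/tpi_eq/teq_tenDl.
- by rewrite (_ : tpi TZero = 0) // addr0.
- by rewrite !opE IH opprD.
- by rewrite !addE IHa IHb addrACA.
Qed.

HB.instance Definition _ := GRing.Zmodule_isLmodule.Build R tensor
  tscaleA tscale1 tscaleDr tscaleDl.

End TensorProduct.

Section Annihilators.
Local Open Scope classical_set_scope.

Definition annihilator (R : nzRingType) (M : lmodType R) : set R :=
  [set r | forall m : M, r *: m = 0].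

Definition ring_center (R : nzRingType) : set R :=
  [set c | forall r, c * r = r * c].

(* R A, the set of finite sums of products r a with a in A. *)
Definition left_ideal_gen (R : nzRingType) (A : set R) : set R :=
  [set x | exists (n : nat) (r a : 'I_n -> R),
     (forall i, A (a i)) /\ x = \sum_(i < n) r i * a i].

End Annihilators.
Arguments ring_center : clear implicits.

Section Schroedinger.
Variable K : fieldType.

Definition schroedinger : Type := 'rV[K]_6.
HB.instance Definition _ := Vector.on schroedinger.

Definition sch_e : schroedinger := delta_mx 0 (inord 0%N).
Definition sch_h : schroedinger := delta_mx 0 (inord 1%N).
Definition sch_f : schroedinger := delta_mx 0 (inord 2%N).
Definition sch_p : schroedinger := delta_mx 0 (inord 3%N).
Definition sch_q : schroedinger := delta_mx 0 (inord 4%N).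
Definition sch_z : schroedinger := delta_mx 0 (inord 5%N).

(* The alternating bilinear extension of the nonzero brackets of the basis
   (e, h, f, p, q, z): [m i j] is the coefficient of the bracket of the i-th and
   j-th basis vectors in that of x and y. See [sch_brackets] below. *)
Definition sch_lie (x y : schroedinger) : schroedinger :=
  let m (i j : nat) : K :=
    x 0 (inord i) * y 0 (inord j) - x 0 (inord j) * y 0 (inord i) in
  m 1%N 0%N *: (2 *: sch_e)
  + m 0%N 2%N *: sch_h
  + m 1%N 2%N *: (- (2 *: sch_f))
  + m 0%N 4%N *: sch_p
  + m 1%N 3%N *: sch_p
  + m 2%N 3%N *: sch_q
  + m 1%N 4%N *: (- sch_q)
  + m 3%N 4%N *: sch_z.

Lemma inord6_eq (i j : nat) : (i < 6)%N -> (j < 6)%N ->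
  (inord i == inord j :> 'I_6) = (i == j).
Proof. by move=> i6 j6; rewrite -val_eqE /= !inordK. Qed.

Lemma sch_addE (x y : schroedinger) i : (x + y) 0 i = x 0 i + y 0 i.
Proof.
have mE (u v : 'rV[K]_6) : (u + v) 0 i = u 0 i + v 0 i by rewrite mxE.
exact: mE.
Qed.

Lemma sch_oppE (x : schroedinger) i : (- x) 0 i = - x 0 i.
Proof.
have mE (u : 'rV[K]_6) : (- u) 0 i = - u 0 i by rewrite mxE.
exact: mE.
Qed.

Lemma sch_scaleE k (x : schroedinger) i : (k *: x) 0 i = k * x 0 i.
Proof.
have mE (u : 'rV[K]_6) : (k *: u) 0 i = k * u 0 i by rewrite mxE.
exact: mE.
Qed.

Lemma sch_zeroE i : (0 : schroedinger) 0 i = 0.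
Proof.
have mE : (0 : 'rV[K]_6) 0 i = 0 by rewrite mxE.
exact: mE.
Qed.

Let schE := (sch_addE, sch_oppE, sch_scaleE, sch_zeroE).

Lemma sch_lie_coord (x y : schroedinger) :
  let m (i j : nat) : K :=
    x 0 (inord i) * y 0 (inord j) - x 0 (inord j) * y 0 (inord i) in
  let s := sch_lie x y in
  [/\ s 0 (inord 0%N) = 2 * m 1%N 0%N, s 0 (inord 1%N) = m 0%N 2%N,
      s 0 (inord 2%N) = - 2 * m 1%N 2%N, s 0 (inord 3%N) = m 0%N 4%N + m 1%N 3%N &
      s 0 (inord 4%N) = m 2%N 3%N - m 1%N 4%N /\ s 0 (inord 5%N) = m 3%N 4%N].
Proof.
rewrite /sch_lie /sch_e /sch_h /sch_f /sch_p /sch_q /sch_z.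
by split; last split; rewrite !schE !mxE !inord6_eq //= ; ring.
Qed.

Lemma sch_eqP (x y : schroedinger) :
  x 0 (inord 0%N) = y 0 (inord 0%N) -> x 0 (inord 1%N) = y 0 (inord 1%N) ->
  x 0 (inord 2%N) = y 0 (inord 2%N) -> x 0 (inord 3%N) = y 0 (inord 3%N) ->
  x 0 (inord 4%N) = y 0 (inord 4%N) -> x 0 (inord 5%N) = y 0 (inord 5%N) -> x = y.
Proof.
move=> e0 e1 e2 e3 e4 e5; apply/rowP => i; rewrite -(inord_val i).
by case: i => -[|[|[|[|[|[|//]]]]]].
Qed.

Lemma sch_lie_axioms :
  [/\ forall (y : schroedinger) (k : K) (x x' : schroedinger),
        sch_lie (k *: x + x') y = k *: sch_lie x y + sch_lie x' y,
      forall (x : schroedinger) (k : K) (y y' : schroedinger),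
        sch_lie x (k *: y + y') = k *: sch_lie x y + sch_lie x y',
      forall x, sch_lie x x = 0 &
      forall x y z, sch_lie x (sch_lie y z) + sch_lie y (sch_lie z x)
        + sch_lie z (sch_lie x y) = 0].
Proof.
have eqP6 := sch_eqP; have /= := sch_lie_coord; move: sch_lie eqP6.
move: (@inord 5 0%N) (@inord 5 1%N) (@inord 5 2%N) (@inord 5 3%N) (@inord 5 4%N)
  (@inord 5 5%N) => i0 i1 i2 i3 i4 i5 br eqP6 brE.
have b0 u v : br u v 0 i0 = 2 * (u 0 i1 * v 0 i0 - u 0 i0 * v 0 i1).
  by have [h _ _ _ _] := brE u v; exact: h.
have b1 u v : br u v 0 i1 = u 0 i0 * v 0 i2 - u 0 i2 * v 0 i0.
  by have [_ h _ _ _] := brE u v; exact: h.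
have b2 u v : br u v 0 i2 = - 2 * (u 0 i1 * v 0 i2 - u 0 i2 * v 0 i1).
  by have [_ _ h _ _] := brE u v; exact: h.
have b3 u v : br u v 0 i3 = u 0 i0 * v 0 i4 - u 0 i4 * v 0 i0
    + (u 0 i1 * v 0 i3 - u 0 i3 * v 0 i1).
  by have [_ _ _ h _] := brE u v; exact: h.
have b4 u v : br u v 0 i4 = u 0 i2 * v 0 i3 - u 0 i3 * v 0 i2
    - (u 0 i1 * v 0 i4 - u 0 i4 * v 0 i1).
  by have [_ _ _ _ [h _]] := brE u v; exact: h.
have b5 u v : br u v 0 i5 = u 0 i3 * v 0 i4 - u 0 i4 * v 0 i3.
  by have [_ _ _ _ [_ h]] := brE u v; exact: h.
pose bE := (b0, b1, b2, b3, b4, b5).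
split=> [y k x x'|x k y y'|x|x y z]; apply: eqP6; rewrite !schE !bE ?schE ?bE.
all: move: (x 0 i0) (x 0 i1) (x 0 i2) (x 0 i3) (x 0 i4) (x 0 i5).
all: move=> x0 x1 x2 x3 x4 x5; ring.
Qed.

HB.instance Definition _ := Lmodule_isLieAlgebra.Build K schroedinger
  (let: And4 l _ _ _ := sch_lie_axioms in l)
  (let: And4 _ r _ _ := sch_lie_axioms in r)
  (let: And4 _ _ a _ := sch_lie_axioms in a)
  (let: And4 _ _ _ j := sch_lie_axioms in j).

Lemma sch_brackets :
  [/\ [/\ lie sch_h sch_e = 2 *: sch_e, lie sch_e sch_f = sch_h,
          lie sch_h sch_f = - (2 *: sch_f), lie sch_e sch_q = sch_p &
          lie sch_e sch_p = 0],
      [/\ lie sch_h sch_p = sch_p, lie sch_f sch_p = sch_q,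
          lie sch_f sch_q = 0, lie sch_h sch_q = - sch_q &
          lie sch_p sch_q = sch_z] &
      forall x, lie sch_z x = 0].
Proof.
have simp (i j : nat) : (i < 6)%N -> (j < 6)%N ->
    (delta_mx 0 (inord i) : schroedinger) 0 (inord j) = (i == j)%:R.
  by move=> i6 j6; rewrite mxE /= inord6_eq // eq_sym.
have lieE (x y : schroedinger) : lie x y = sch_lie x y by [].
split; [split|split|move=> x].
all: apply: sch_eqP; rewrite lieE.
all: match goal with |- context [sch_lie ?x ?y] =>
  have [e0 e1 e2 e3 [e4 e5]] := sch_lie_coord x y end.
all: rewrite ?(e0, e1, e2, e3, e4, e5) {e0 e1 e2 e3 e4 e5}.
all: rewrite ?schE /sch_e /sch_h /sch_f /sch_p /sch_q /sch_z ?simp //=.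
all: ring.
Qed.

Definition cartan_space : {vspace schroedinger} := (<[sch_h]> + <[sch_z]>)%VS.
Definition nplus_space : {vspace schroedinger} := (<[sch_e]> + <[sch_p]>)%VS.
Definition borel_space : {vspace schroedinger} :=
  (cartan_space + nplus_space)%VS.

Lemma in_cartan x : reflect (exists a b, x = a *: sch_h + b *: sch_z)
  (x \in cartan_space).
Proof.
apply: (iffP memv_addP) => [[_ /vlineP[a ->] [_ /vlineP[b ->] ->]]|[a [b ->]]].
  by exists a, b.
exists (a *: sch_h); first by rewrite memvZ ?memv_line.
by exists (b *: sch_z); rewrite ?memvZ ?memv_line.
Qed.

Lemma in_nplus x : reflect (exists a b, x = a *: sch_e + b *: sch_p)
  (x \in nplus_space).
Proof.
apply: (iffP memv_addP) => [[_ /vlineP[a ->] [_ /vlineP[b ->] ->]]|[a [b ->]]].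
  by exists a, b.
exists (a *: sch_e); first by rewrite memvZ ?memv_line.
by exists (b *: sch_p); rewrite ?memvZ ?memv_line.
Qed.

Lemma cartan_nplus_direct : (cartan_space :&: nplus_space = 0)%VS.
Proof.
apply/eqP; rewrite -subv0; apply/subvP => x; rewrite memv_cap memv0.
case/andP => /in_cartan[a [b xE]] /in_nplus[c [d xE']].
have x1 := congr1 (fun s : schroedinger => s 0 (inord 1%N)) xE'.
have x5 := congr1 (fun s : schroedinger => s 0 (inord 5%N)) xE'.
move: x1 x5; rewrite xE !schE !mxE !inord6_eq //=.
rewrite !(mulr0, mulr1, addr0, add0r) => -> ->.
by rewrite !scale0r addr0.
Qed.

Lemma borel_coord x : x \in borel_space ->
  x 0 (inord 2%N) = 0 /\ x 0 (inord 4%N) = 0.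
Proof.
case/memv_addP => _ /in_cartan[a [b ->]] [_ /in_nplus[c [d ->]] ->].
by rewrite !schE !mxE !inord6_eq //= !(mulr0, addr0).
Qed.

(* [b, b] is contained in n_+. *)
Lemma borel_lie x y : x \in borel_space -> y \in borel_space ->
  sch_lie x y \in nplus_space.
Proof.
move=> /borel_coord[x2 x4] /borel_coord[y2 y4].
have [_ s1 s2 _ [s4 s5]] := sch_lie_coord x y.
rewrite x2 x4 y2 y4 !(mulr0, mul0r, subr0) in s1 s2 s4 s5.
apply/in_nplus; exists (sch_lie x y 0 (inord 0%N)), (sch_lie x y 0 (inord 3%N)).
by apply: sch_eqP; rewrite ?s1 ?s2 ?s4 ?s5 !schE !mxE !inord6_eq //=;
  rewrite !(mulr0, mulr1, addr0, add0r).
Qed.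

Definition cartan : Type := subvs_of cartan_space.
HB.instance Definition _ := Vector.on cartan.

Definition borel : Type := subvs_of borel_space.
HB.instance Definition _ := Vector.on borel.

Definition borel_lieop (x y : borel) : borel :=
  vsproj borel_space (sch_lie (vsval x) (vsval y)).

Lemma borel_lieopE x y :
  vsval (borel_lieop x y) = sch_lie (vsval x) (vsval y).
Proof.
apply: vsprojK; apply: subvP (addvSr _ _) _ _.
by apply: borel_lie; apply: subvsP.
Qed.

Fact borel_lie_linearl (y : borel) (k : K) (x x' : borel) :
  borel_lieop (k *: x + x') y = k *: borel_lieop x y + borel_lieop x' y.
Proof.
by rewrite /borel_lieop linearP [sch_lie _ _]lie_linearl linearP.
Qed.

Fact borel_lie_linearr (x : borel) (k : K) (y y' : borel) :
  borel_lieop x (k *: y + y') = k *: borel_lieop x y + borel_lieop x y'.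
Proof.
by rewrite /borel_lieop linearP [sch_lie _ _]lie_linearr linearP.
Qed.

Fact borel_liexx x : borel_lieop x x = 0.
Proof. by rewrite /borel_lieop [sch_lie _ _]liexx linear0. Qed.

Fact borel_jacobi x y z :
  borel_lieop x (borel_lieop y z) + borel_lieop y (borel_lieop z x)
  + borel_lieop z (borel_lieop x y) = 0.
Proof. by apply: subvs_inj; rewrite !linearD /= !borel_lieopE; apply: lie_jacobi. Qed.

HB.instance Definition _ := Lmodule_isLieAlgebra.Build K borel
  borel_lie_linearl borel_lie_linearr borel_liexx borel_jacobi.

Definition borel_incl (x : borel) : enveloping schroedinger :=
  ugen (vsval x).

Fact borel_incl_linear : linear borel_incl.
Proof. by move=> k x y; rewrite /borel_incl !linearP. Qed.

HB.instance Definition _ := GRing.isLinear.Build K borel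
  (enveloping schroedinger) _ borel_incl borel_incl_linear.

Fact borel_incl_lie : lie_to_assoc borel_incl.
Proof.
by move=> x y; rewrite /borel_incl [vsval _]borel_lieopE; apply: ugen_lie.
Qed.

Definition Uborel_map : {rmorphism enveloping borel -> enveloping schroedinger} :=
  ulift borel_incl_lie.

Section Verma.
Variable lambda : {linear cartan -> K^o}.

(* lambda composed with the projection of b = h (+) n_+ onto h. *)
Definition borel_char (x : borel) : K^o :=
  lambda (vsproj cartan_space (daddv_pi cartan_space nplus_space (vsval x))).

Lemma borel_char_cartan (x : borel) (xh : cartan) :
  vsval x = vsval xh -> borel_char x = lambda xh.
Proof.
move=> xE; rewrite /borel_char xE daddv_pi_id ?vsvalK ?subvsP //.
exact: cartan_nplus_direct.
Qed.

Lemma borel_char_nplus (x : borel) : vsval x \in nplus_space ->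
  borel_char x = 0.
Proof.
move=> xn; rewrite /borel_char.
have nh : (nplus_space :&: cartan_space = 0)%VS.
  by rewrite capvC cartan_nplus_direct.
have := daddv_pi_add cartan_nplus_direct (subvsP x).
rewrite (daddv_pi_id nh xn) => /eqP; rewrite -subr_eq0 addrK => /eqP ->.
by rewrite !linear0.
Qed.

Fact borel_char_linear : linear borel_char.
Proof. by move=> k x y; rewrite /borel_char !linearP. Qed.

HB.instance Definition _ :=
  GRing.isLinear.Build K borel K^o _ borel_char borel_char_linear.

Fact borel_char_lie : lie_to_assoc borel_char.
Proof.
move=> x y; rewrite mulrC subrr borel_char_nplus // [vsval _]borel_lieopE.
by apply: borel_lie; apply: subvsP.
Qed.

Definition Uborel_char : {rmorphism enveloping borel -> K^o} :=
  ulift borel_char_lie.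

(* The one-dimensional U(b)-module C_lambda; [lambda] is a phantom argument
   selecting the action. *)
Definition one_dim_module of {linear cartan -> K^o} : Type := K.
HB.instance Definition _ := GRing.Zmodule.on (one_dim_module lambda).

Definition one_dim_scale (u : enveloping borel) (c : one_dim_module lambda) :
  one_dim_module lambda := Uborel_char u * (c : K).

Fact one_dim_scaleA u v c :
  one_dim_scale u (one_dim_scale v c) = one_dim_scale (u * v) c.
Proof. by rewrite /one_dim_scale rmorphM mulrA. Qed.

Fact one_dim_scale1 : left_id 1 one_dim_scale.
Proof. by move=> c; rewrite /one_dim_scale rmorph1 mul1r. Qed.

Fact one_dim_scaleDr : right_distributive one_dim_scale +%R.
Proof. by move=> u c d; rewrite /one_dim_scale mulrDr. Qed.

Fact one_dim_scaleDl c : {morph one_dim_scale^~ c : u v / u + v}.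
Proof. by move=> u v; rewrite /one_dim_scale rmorphD mulrDl. Qed.

HB.instance Definition _ :=
  GRing.Zmodule_isLmodule.Build (enveloping borel) (one_dim_module lambda)
    one_dim_scaleA one_dim_scale1 one_dim_scaleDr one_dim_scaleDl.

Definition Verma : lmodType (enveloping schroedinger) :=
  tensor Uborel_map (one_dim_module lambda).

End Verma.
End Schroedinger.

(* Main.v *)
(* The annihilator of Delta(lambda) turns out to be generated by z - b and
   c - chi, where c is the cubic Casimir element, b = lambda(z), and chi is the
   scalar by which c acts.  Modulo these two elements U is spanned by the ordered
   monomials f^i q^j p^l e^m h^k with i = 0 or l <= 1, because c rewrites f p^2.
   It remains to see that a combination of such monomials killing the Verma
   module is zero.  The action on f^I q^J v has coefficients polynomial in I and
   J, so the combination also acts by zero on a generic vector, over K[I, J].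
   There each monomial has an explicit leading term, where the exponent of q is
   compared first, and distinct monomials of the above shape have distinct
   leading terms.  The argument does not distinguish b = 0 from b <> 0, because
   the terms containing b are never leading. *)
From Stdlib Require Import Ncring Ncring_tac.
Require Import Defs.
From mathcomp Require Import all_boot all_order all_algebra.
From mathcomp Require Import boolp classical_sets reals complex ring zify.

Set Implicit Arguments.
Unset Strict Implicit.
Unset Printing Implicit Defensive.

Import Order.TTheory GRing.Theory Num.Theory.
Local Open Scope ring_scope.

(** * Identities in noncommutative rings *)

#[local] Instance nzRing_ops (A : nzRingType) :
  @Ring_ops A 0 1 +%R *%R (fun x y => x - y) -%R (@eq A) := {}.

(** This makes [non_commutative_ring] available in every [nzRingType], in particular for the words
    that arise in commutators with the Casimir element. *)
#[local] Instance nzRing_ring (A : nzRingType) : Ring (Ro := nzRing_ops A).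
Proof.
split; first exact: RelationClasses.eq_equivalence.
all: try by move=> ? ? /= -> ? ? ->.
all: try by move=> ? ? /= ->.
- exact: add0r.
- exact: addrC.
- exact: addrA.
- exact: mul1r.
- exact: mulr1.
- exact: mulrA.
- exact: mulrDl.
- by move=> x y z; apply: mulrDr.
- by [].
- exact: subrr.
Qed.

(** * The cubic Casimir element *)

Section Casimir.
Variables (A : nzRingType) (e f h p q z : A).

(* For z invertible, e - p^2/2z, f + q^2/2z and h + (pq + qp)/2z span a copy of
   sl_2 commuting with p and q; this is z times its Casimir element, up to a
   multiple of z. *)
Definition casimir : A :=
  z * (h * h + h *+ 3 + (f * e) *+ 4) + (q * p * (h + 1 *+ 2)) *+ 2
  + (q * q * e) *+ 2 - (f * p * p) *+ 2.

Hypotheses (ef : e * f = f * e + h) (hf : h * f = f * h - f *+ 2)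
  (he : h * e = e * h + e *+ 2) (pf : p * f = f * p - q) (qf : q * f = f * q)
  (pq : p * q = q * p + z) (eq_q : e * q = q * e + p) (hq : h * q = q * h - q)
  (ep : e * p = p * e) (hp : h * p = p * h + p) (zC : forall y, y * z = z * y).

Let ord (u v w : A) : u * v = w -> forall y, u * (v * y) = w * y.
Proof. by move=> uv y; rewrite mulrA uv. Qed.

Lemma casimir_commutes : (q * casimir = casimir * q)
  * (f * casimir = casimir * f) * (e * casimir = casimir * e).
Proof.
have zCA u y : u * (z * y) = z * (u * y) by rewrite mulrA zC -mulrA.
have eh : e * h = h * e - e *+ 2 by rewrite he addrK.
(* Each rule moves a word towards the order z, f, q, p, e, h. Words are kept associated to the
   right, so each relation is also needed with a tail, through [ord] and [zCA]. *)
pose rules := (zC f, zC q, zC p, zC e, zC h, zCA f, zCA q, zCA p, zCA e, zCA h,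
 (ord ef, ord hf, ord he, ord pf, ord qf), (ord pq, ord eq_q, ord hq, ord ep, ord hp),
 (ef, hf, he, pf, qf), (pq, eq_q, hq, ep, hp)).
rewrite /casimir !mulrS !mulr0n !addr0.
by split; [split|];
do 8 rewrite ?(mulrDl, mulrDr, mulrBl, mulrBr, mulrN, mulNr, mul1r, mulr1) -?mulrA ?rules
   ?mulrS ?mulr0n ?addr0; non_commutative_ring.
Qed.

End Casimir.

(* (i, j, l, m, k) stands for f^i q^j p^l e^m h^k. *)
Definition expo : Type := nat * nat * nat * nat * nat.

Definition reduced (t : expo) : bool :=
  let '(i, _, l, _, _) := t in (i == 0%N) || (l <= 1)%N.

(** * Reduction to reduced monomials modulo the central ideal *)

Section Straightening.
Variables (K : fieldType) (A : algType K) (e f h p q z : A) (b chi : K).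
Hypotheses (ef : e * f = f * e + h) (hf : h * f = f * h - f *+ 2)
  (he : h * e = e * h + e *+ 2) (pf : p * f = f * p - q) (qf : q * f = f * q)
  (pq : p * q = q * p + z) (eq_q : e * q = q * e + p) (hq : h * q = q * h - q)
  (ep : e * p = p * e) (hp : h * p = p * h + p) (zC : forall y, y * z = z * y).
Let c := casimir e f h p q z.
Hypothesis cC : forall y, y * c = c * y.
Hypothesis two_neq0 : 2%:R != 0 :> K.

Definition monom (t : expo) : A :=
  let '(i, j, l, m, k) := t in f ^+ i * q ^+ j * p ^+ l * e ^+ m * h ^+ k.

Definition central_ideal (y : A) : Prop :=
  exists u v, y = u * (z - b%:A) + v * (c - chi%:A).

(** This set will turn out to contain 1 and to be stable under left multiplication by every
    generator, which makes it the whole enveloping algebra. *)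
Definition in_span (y : A) : Prop :=
  exists s : seq (K * expo), all (fun x => reduced x.2) s /\
    central_ideal (y - \sum_(x <- s) x.1 *: monom x.2).

Let J := central_ideal.
Let W := in_span.

Lemma central_ideal0 : J 0.
Proof. by exists 0, 0; rewrite !mul0r addr0. Qed.

Lemma central_idealD x y : J x -> J y -> J (x + y).
Proof.
by case=> u [v ->] [u' [v' ->]]; exists (u + u'), (v + v'); rewrite !mulrDl addrACA.
Qed.

Lemma central_idealMl a x : J x -> J (a * x).
Proof.
by case=> u [v ->]; exists (a * u), (a * v); rewrite mulrDr !mulrA.
Qed.

Lemma central_idealZ k x : J x -> J (k *: x).
Proof. by move=> Jx; rewrite -mulr_algl; apply: central_idealMl. Qed.

Lemma in_span_ideal y : J y -> W y.
Proof. by move=> Jy; exists [::]; rewrite big_nil subr0. Qed.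

Lemma in_span_reduced t : reduced t -> W (monom t).
Proof.
move=> rt; exists [:: (1, t)]; rewrite big_seq1 scale1r subrr /= rt.
by split=> //; apply: central_ideal0.
Qed.

Lemma in_spanD x y : W x -> W y -> W (x + y).
Proof.
case=> s [rs Jx] [s' [rs' Jy]]; exists (s ++ s'); rewrite all_cat rs rs' big_cat.
by split=> //=; rewrite opprD addrACA; apply: central_idealD.
Qed.

Lemma in_spanZ k x : W x -> W (k *: x).
Proof.
case=> s [rs Jx]; exists [seq (k * u.1, u.2) | u <- s]; split.
  by rewrite all_map.
rewrite big_map -(eq_bigr _ (fun u _ => scalerA k u.1 (monom u.2))) -scaler_sumr.
by rewrite -scalerBr; apply: central_idealZ.
Qed.

Lemma in_span0 : W 0. Proof. exact/in_span_ideal/central_ideal0. Qed.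

Lemma in_spanN x : W x -> W (- x).
Proof. by move=> Wx; rewrite -scaleN1r; apply: in_spanZ. Qed.

Lemma in_spanB x y : W x -> W y -> W (x - y).
Proof. by move=> Wx /in_spanN; apply: in_spanD. Qed.

Lemma in_spanMn n x : W x -> W (x *+ n).
Proof. by move=> Wx; rewrite -scaler_nat; apply: in_spanZ. Qed.

(** Modulo the ideal z is the scalar b, because z x = x (z - b) + b x; likewise c is the scalar chi
    in the next lemma. *)
Lemma in_spanMz x : W x -> W (z * x).
Proof.
move=> Wx; rewrite -zC -[z](addrNK b%:A) mulrDr mulr_algr; apply: in_spanD.
  by apply: in_span_ideal; exists x, 0; rewrite mul0r addr0.
exact: in_spanZ.
Qed.

Lemma in_spanMc x : W x -> W (c * x).
Proof.
move=> Wx; rewrite -cC -[c](addrNK chi%:A) mulrDr mulr_algr; apply: in_spanD.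
  by apply: in_span_ideal; exists 0, x; rewrite mul0r add0r.
exact: in_spanZ.
Qed.

Lemma in_span_mull g : (forall t, reduced t -> W (g * monom t)) ->
  forall y, W y -> W (g * y).
Proof.
move=> Wg y [s [rs Js]].
rewrite -[y](addrNK (\sum_(x <- s) x.1 *: monom x.2)) mulrDr; apply: in_spanD.
  exact/in_span_ideal/central_idealMl.
rewrite mulr_sumr; elim: s rs {Js} => [|x s IH] /=.
  by rewrite big_nil => _; apply: in_span0.
case/andP=> rx rs; rewrite big_cons; apply: in_spanD; last exact: IH.
by rewrite -scalerAr; apply/in_spanZ/Wg.
Qed.

(** The tail of a monomial: left multiplication by [p] or [e] only raises an exponent, and [h] does
    so up to a multiple of the tail. *)
Let T l m k := p ^+ l * (e ^+ m * h ^+ k).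

Lemma monomE i j l m k : monom (i, j, l, m, k) = f ^+ i * (q ^+ j * T l m k).
Proof. by rewrite /monom !mulrA. Qed.

Lemma monomE_q j l m k : q ^+ j * T l m k = monom (0%N, j, l, m, k).
Proof. by rewrite monomE mul1r. Qed.

Lemma monomE_p l m k : T l m k = monom (0%N, 0%N, l, m, k).
Proof. by rewrite -monomE_q mul1r. Qed.

(** [ad h] is a derivation with eigenvectors f, q, p, e of eigenvalues -2, -1, 1, 2, so moving [h]
    past a power only adds a multiple of it. *)
Lemma weight_f i y : h * (f ^+ i * y) = f ^+ i * (h * y) - (f ^+ i * y) *+ (2 * i).
Proof.
elim: i => [|i IH]; first by rewrite muln0 !expr0 !mul1r subr0.
rewrite !exprS -!mulrA mulrA hf mulrBl -!mulrA IH mulrBr mulrnAr mulrnAl.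
by rewrite -addrA -opprD -mulrnDr mulnS addnC.
Qed.

Lemma weight_q j y : h * (q ^+ j * y) = q ^+ j * (h * y) - (q ^+ j * y) *+ j.
Proof.
elim: j => [|j IH]; first by rewrite !expr0 !mul1r subr0.
rewrite !exprS -!mulrA mulrA hq mulrBl -!mulrA IH mulrBr mulrnAr.
by rewrite -addrA -opprD -mulrSr.
Qed.

Lemma weight_p l y : h * (p ^+ l * y) = p ^+ l * (h * y) + (p ^+ l * y) *+ l.
Proof.
elim: l => [|l IH]; first by rewrite !expr0 !mul1r addr0.
rewrite !exprS -!mulrA mulrA hp mulrDl -!mulrA IH mulrDr mulrnAr.
by rewrite -addrA -mulrSr.
Qed.

Lemma weight_e m y : h * (e ^+ m * y) = e ^+ m * (h * y) + (e ^+ m * y) *+ (2 * m).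
Proof.
elim: m => [|m IH]; first by rewrite muln0 !expr0 !mul1r addr0.
rewrite !exprS -!mulrA mulrA he mulrDl -!mulrA IH mulrDr mulrnAr mulrnAl.
by rewrite -addrA -mulrnDr mulnS addnC.
Qed.

Lemma weight_T l m k : h * T l m k = T l m k.+1 + T l m k *+ (l + 2 * m).
Proof.
rewrite /T weight_p weight_e exprS mulrDr -addrA [in RHS]mulrnDr; congr (_ + _).
by rewrite mulrnAr addrC.
Qed.

Lemma qfX i : q * f ^+ i = f ^+ i * q.
Proof. by apply: commrX; apply: qf. Qed.

Lemma epX l : e * p ^+ l = p ^+ l * e.
Proof. by apply: commrX; apply: ep. Qed.

Lemma e_T l m k : e * T l m k = T l m.+1 k.
Proof. by rewrite /T mulrA epX exprS -!mulrA. Qed.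

Lemma p_T l m k : p * T l m k = T l.+1 m k.
Proof. by rewrite /T mulrA -exprS. Qed.

(** Apart from the central [c], each term on the right contains at most one [p]. *)
Lemma casimir_fpp : (f * p * p) *+ 2 =
  z * (h * h + h *+ 3 + (f * e) *+ 4) + (q * p * (h + 1 *+ 2)) *+ 2
  + (q * q * e) *+ 2 - c.
Proof. by rewrite /c /casimir opprB addrC subrK. Qed.

(** Strong induction on the exponent of [p]: a monomial that is not reduced contains f p^2, which
    [casimir_fpp] replaces by words with fewer [p], while z and c are scalars modulo the ideal. *)
Lemma in_span_monom t : W (monom t).
Proof.
case: t => [[[[i j] l] m] k].
elim/ltn_ind: l i j m k => -[|[|l]] IH i j m k; try exact/in_span_reduced/orbT.
case: i => [|i]; first exact: in_span_reduced.
have WT i' j' l' m' k' : (l' < l.+2)%N -> W (f ^+ i' * (q ^+ j' * T l' m' k')).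
  by move=> ll; rewrite -monomE; apply: IH.
have fqX j' : f * q ^+ j' = q ^+ j' * f by apply: commrX.
have -> : monom (i.+1, j, l.+2, m, k) =
    2%:R^-1 *: (f ^+ i * (q ^+ j * ((f * p * p) *+ 2 * T l m k))).
  rewrite mulrnAl !mulrnAr -[X in _ *: X]scaler_nat scalerA mulVf // scale1r.
  rewrite /monom /T exprSr !exprS -!mulrA; congr (_ * _).
  by rewrite !mulrA fqX.
(* [d] is [c] with its definition forgotten, so that distributing below leaves it a single central
   factor. *)
have [d [fppE dC Wd]] : exists d, [/\ (f * p * p) *+ 2 =
    z * (h * h + h *+ 3 + (f * e) *+ 4) + (q * p * (h + 1 *+ 2)) *+ 2
    + (q * q * e) *+ 2 - d, forall y, y * d = d * y & forall x, W x -> W (d * x)].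
  by exists c; split; [apply: casimir_fpp|apply: cC|apply: in_spanMc].
apply: in_spanZ; rewrite fppE.
have zCA u y : u * (z * y) = z * (u * y) by rewrite mulrA zC -mulrA.
have dCA u y : u * (d * y) = d * (u * y) by rewrite mulrA dC -mulrA.
have qS j' y : q ^+ j' * (q * y) = q ^+ j'.+1 * y by rewrite exprSr -mulrA.
have fS i' j' y : f ^+ i' * (q ^+ j' * (f * y)) = f ^+ i'.+1 * (q ^+ j' * y).
  by rewrite (mulrA _ f) -fqX exprSr -!mulrA.
rewrite !(mulrBl, mulrDl, mulrBr, mulrDr, mulrnAl, mulrnAr, mulr1) -!mulrA !(zCA, dCA).
rewrite !(fS, qS, e_T, p_T, weight_T, mulrDr, mulrnAr).
by repeat first [apply: in_spanB | apply: in_spanD | apply: in_spanMn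
  | apply: in_spanMz | apply: Wd | apply: WT].
Qed.

Lemma in_spanMf y : W y -> W (f * y).
Proof.
apply: in_span_mull => -[[[[i j] l] m] k] _.
by rewrite /monom !mulrA -exprS; apply: (in_span_monom (_, _, _, _, _)).
Qed.

Lemma in_spanMq y : W y -> W (q * y).
Proof.
apply: in_span_mull => -[[[[i j] l] m] k] _.
rewrite /monom !mulrA qfX -(mulrA (f ^+ i)) -exprS.
exact: (in_span_monom (_, _, _, _, _)).
Qed.

Lemma in_spanMh y : W y -> W (h * y).
Proof.
apply: in_span_mull => -[[[[i j] l] m] k] _.
rewrite monomE weight_f weight_q weight_T.
rewrite !(mulrBr, mulrDr, mulrnAr).
by repeat first [apply: in_spanB | apply: in_spanD | apply: in_spanMn];
  rewrite -monomE; apply: in_span_monom.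
Qed.

(** [p] passes f and q at the cost of q and z, and [e] passes them at the cost of h and p. This
    dictates the order in which the stability lemmas are proved. *)
Lemma in_spanMp y : W y -> W (p * y).
Proof.
apply: in_span_mull => -[[[[i j] l] m] k] _.
rewrite monomE.
elim: i => [|i IH]; last first.
  rewrite exprS -mulrA mulrA pf mulrBl -!mulrA; apply: in_spanB.
    exact: in_spanMf.
  by rewrite -monomE; apply/in_spanMq/in_span_monom.
rewrite expr0 mul1r; elim: j => [|j IH].
  by rewrite expr0 mul1r p_T monomE_p; apply: in_span_monom.
rewrite exprS -mulrA mulrA pq mulrDl -!mulrA; apply: in_spanD.
  exact: in_spanMq.
by apply: in_spanMz; rewrite monomE_q; apply: in_span_monom.
Qed.

Lemma in_spanMe y : W y -> W (e * y).
Proof.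
apply: in_span_mull => -[[[[i j] l] m] k] _.
rewrite monomE.
elim: i => [|i IH]; last first.
  rewrite exprS -mulrA mulrA ef mulrDl -!mulrA; apply: in_spanD.
    exact: in_spanMf.
  by rewrite -monomE; apply/in_spanMh/in_span_monom.
rewrite expr0 mul1r; elim: j => [|j IH].
  by rewrite expr0 mul1r e_T monomE_p; apply: in_span_monom.
rewrite exprS -mulrA mulrA eq_q mulrDl -!mulrA; apply: in_spanD.
  exact: in_spanMq.
by apply: in_spanMp; rewrite monomE_q; apply: in_span_monom.
Qed.

Lemma in_span1 : W 1.
Proof.
by have := in_span_monom (0, 0, 0, 0, 0)%N; rewrite /monom !expr0 !mulr1.
Qed.


End Straightening.

(** * The Verma module as a module of functions on Z x Z *)

Section ShiftModule.
Variables (K : fieldType) (R : comNzRingType) (iota : {rmorphism K -> R}).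
Variables (a beta : K) (I J : R).

Let S := schroedinger K.
Let G := int -> int -> R.

(* [phi r s] is the coefficient of a vector v_(r, s) behaving like
   f^(I + r) q^(J + s) v, where v is a highest weight vector on which h and z act
   by [a] and [2 beta]. Indices range over Z; no truncation is needed, since
   the coefficients vanish where an exponent would become negative. *)
Definition shift_e (phi : G) : G := fun r s =>
  iota beta * (J + s%:~R + 2) * (J + s%:~R + 1) * phi r (s + 2)
  + (I + r%:~R + 1) * (iota a - (J + s%:~R) - (I + r%:~R)) * phi (r + 1) s.
Definition shift_h (phi : G) : G := fun r s =>
  (iota a - 2 * (I + r%:~R) - (J + s%:~R)) * phi r s.
Definition shift_f (phi : G) : G := fun r s => phi (r - 1) s.
Definition shift_p (phi : G) : G := fun r s =>
  2 * iota beta * (J + s%:~R + 1) * phi r (s + 1)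
  - (I + r%:~R + 1) * phi (r + 1) (s - 1).
Definition shift_q (phi : G) : G := fun r s => phi r (s - 1).

(** The operators come from moving e and p to the right: e f^i q^j v = beta j (j - 1) f^i q^(j-2) v
    + i (a - i - j + 1) f^(i-1) q^j v and p f^i q^j v = 2 beta j f^i q^(j-1) v - i f^(i-1) q^(j+1)
    v. *)
Definition shift_gen (x : S) (phi : G) : G := fun r s =>
  iota (x 0 (inord 0)) * shift_e phi r s + iota (x 0 (inord 1)) * shift_h phi r s
  + iota (x 0 (inord 2)) * shift_f phi r s + iota (x 0 (inord 3)) * shift_p phi r s
  + iota (x 0 (inord 4)) * shift_q phi r s
  + iota (x 0 (inord 5)) * (2 * iota beta) * phi r s.

Lemma shift_gen_lie (x y : S) phi r s : shift_gen (lie x y) phi r s =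
  shift_gen x (shift_gen y phi) r s - shift_gen y (shift_gen x phi) r s.
Proof.
rewrite /shift_gen.
have [e0 e1 e2 e3 [e4 e5]] := sch_lie_coord x y.
rewrite [lie x y]/(sch_lie x y) e0 e1 e2 e3 e4 e5 {e0 e1 e2 e3 e4 e5}.
rewrite /shift_e /shift_h /shift_f /shift_p /shift_q.
have c1 (t : int) : (t + 1)%:~R = t%:~R + 1 :> R by rewrite intrD.
have c2 (t : int) : (t + 2)%:~R = t%:~R + 2 :> R by rewrite intrD.
have cB (t : int) : (t - 1)%:~R = t%:~R - 1 :> R by rewrite intrB.
rewrite !(rmorphD iota, rmorphB iota, rmorphM iota, rmorphN iota, rmorph_nat iota).
rewrite !(c1, c2, cB).
rewrite !addrK.
(* The arguments of [phi] are opaque to the final [ring], so shifts reached along different paths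
   are first made equal. *)
have -> : s + 2 + 2 = s + 4 by ring.
have -> : s + 2 + 1 = s + 3 by ring.
have -> : s + 1 + 2 = s + 3 by ring.
have -> : s + 1 + 1 = s + 2 by ring.
have -> : s + 2 - 1 = s + 1 by ring.
have -> : s - 1 + 2 = s + 1 by ring.
rewrite ?subrK.
move: (r%:~R) (s%:~R) (iota a) (iota beta) => r' s' A B.
move: (iota (x 0 _)) (iota (x 0 _)) (iota (x 0 _)) => x0 x1 x2.
move: (iota (x 0 _)) (iota (x 0 _)) (iota (x 0 _)) => x3 x4 x5.
move: (iota (y 0 _)) (iota (y 0 _)) (iota (y 0 _)) => y0 y1 y2.
move: (iota (y 0 _)) (iota (y 0 _)) (iota (y 0 _)) => y3 y4 y5.
ring.
Qed.

Lemma shift_gen_linear (k : R) x phi psi r s :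
  shift_gen x (fun r s => k * phi r s + psi r s) r s
  = k * shift_gen x phi r s + shift_gen x psi r s.
Proof. by rewrite /shift_gen /shift_e /shift_h /shift_f /shift_p /shift_q; ring. Qed.

(** Acting by formal expressions and passing to the quotient avoids building the endomorphism
    algebra that [ulift] would require as a target. *)
Fixpoint shift_term (t : uterm S) (phi : G) : G :=
  match t with
  | UGen x => shift_gen x phi
  | UCst k => fun r s => iota k * phi r s
  | UAdd t t' => fun r s => shift_term t phi r s + shift_term t' phi r s
  | UMul t t' => shift_term t (shift_term t' phi)
  end.

(** Maps [G -> G] need not be linear, yet right distributivity and the centrality of constants in
    [ueq] demand it. *)
Lemma shift_term_linear t (k : R) phi psi :
  shift_term t (fun r s => k * phi r s + psi r s)
  = fun r s => k * shift_term t phi r s + shift_term t psi r s.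
Proof.
elim: t phi psi => [x|l|t IH t' IH'|t IH t' IH'] phi psi /=.
- by apply/funext => r; apply/funext => s; apply: shift_gen_linear.
- by apply/funext => r; apply/funext => s; ring.
- by rewrite IH IH'; apply/funext => r; apply/funext => s; ring.
- by rewrite IH' IH.
Qed.

Lemma shift_termD t phi psi :
  shift_term t (fun r s => phi r s + psi r s)
  = fun r s => shift_term t phi r s + shift_term t psi r s.
Proof.
have := shift_term_linear t 1 phi psi.
rewrite (_ : (fun r s => 1 * phi r s + psi r s) = fun r s => phi r s + psi r s).
  by move=> ->; apply/funext => r; apply/funext => s; rewrite mul1r.
by apply/funext => r; apply/funext => s; rewrite mul1r.
Qed.

Lemma shift_termZ t k phi :
  shift_term t (fun r s => k * phi r s) = fun r s => k * shift_term t phi r s.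
Proof.
have t0 : shift_term t (fun _ _ => 0) = fun _ _ => 0.
  have := shift_term_linear t (-1) (fun _ _ => 0) (fun _ _ => 0).
  rewrite (_ : (fun r s => -1 * 0 + 0) = fun _ _ => 0); last first.
    by apply/funext => r; apply/funext => s; ring.
  by move=> ->; apply/funext => r; apply/funext => s; ring.
have := shift_term_linear t k phi (fun _ _ => 0).
rewrite t0 (_ : (fun r s => k * phi r s + 0) = fun r s => k * phi r s).
  by move=> ->; apply/funext => r; apply/funext => s; rewrite addr0.
by apply/funext => r; apply/funext => s; rewrite addr0.
Qed.

Lemma shift_term_ueq t t' : ueq t t' -> shift_term t = shift_term t'.
Proof.
elim=> //=; try by move=> *; apply/funext => phi; apply/funext => r;
  apply/funext => s; rewrite ?(rmorph0, rmorphN, rmorph1, rmorphD, rmorphM); ring.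
- by move=> ? ? ? _ -> _ ->.
- by move=> ? ? ? ? _ -> _ ->.
- by move=> ? ? ? ? _ -> _ ->.
- move=> u; apply/funext => phi; congr (shift_term u _).
  by apply/funext => r; apply/funext => s; rewrite rmorph1 mul1r.
- by move=> u v w; apply/funext => phi; rewrite shift_termD.
- by move=> k u; apply/funext => phi; rewrite shift_termZ.
- move=> x y; apply/funext => phi; apply/funext => r; apply/funext => s.
  by rewrite /shift_gen !sch_addE !rmorphD; ring.
- move=> k x; apply/funext => phi; apply/funext => r; apply/funext => s.
  by rewrite /shift_gen !sch_scaleE !rmorphM; ring.
- move=> x y; apply/funext => phi; apply/funext => r; apply/funext => s.
  by rewrite shift_gen_lie rmorphN1 mulN1r.
Qed.

Definition shift_act (u : enveloping S) : G -> G := shift_term (urepr u).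

Lemma shift_act_pi t : shift_act (upi t) = shift_term t.
Proof. exact/shift_term_ueq/urepr_pi. Qed.

Lemma shift_act_gen x : shift_act (ugen x) = shift_gen x.
Proof. exact: shift_act_pi. Qed.

Lemma shift_actD u v phi r s :
  shift_act (u + v) phi r s = shift_act u phi r s + shift_act v phi r s.
Proof. by rewrite -[u]ureprK -[v]ureprK /GRing.add /= uaddE !shift_act_pi. Qed.

Lemma shift_actM u v phi : shift_act (u * v) phi = shift_act u (shift_act v phi).
Proof.
by rewrite -[u]ureprK -[v]ureprK /GRing.mul /= umulE !shift_act_pi.
Qed.

Lemma shift_actZ k u phi r s :
  shift_act (k *: u) phi r s = iota k * shift_act u phi r s.
Proof. by rewrite -[u]ureprK /GRing.scale /= uscaleE !shift_act_pi. Qed.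

Lemma shift_act1 phi : shift_act 1 phi = phi.
Proof.
rewrite /GRing.one /= shift_act_pi; apply/funext => r; apply/funext => s /=.
by rewrite rmorph1 mul1r.
Qed.
End ShiftModule.

(** * Central elements acting by scalars *)

Section VermaModule.
Variables (K : fieldType) (lambda : {linear cartan K -> K^o}).

Let S := schroedinger K.
Let U := enveloping S.

Definition weight_h : K := lambda (vsproj (cartan_space K) (sch_h K)).
Definition weight_z : K := lambda (vsproj (cartan_space K) (sch_z K)).

Lemma sch_basis (x : S) : x =
  x 0 (inord 0) *: sch_e K + x 0 (inord 1) *: sch_h K + x 0 (inord 2) *: sch_f K
  + x 0 (inord 3) *: sch_p K + x 0 (inord 4) *: sch_q K + x 0 (inord 5) *: sch_z K.
Proof.
apply: sch_eqP; rewrite /sch_e /sch_h /sch_f /sch_p /sch_q /sch_z;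
  by rewrite !(sch_addE, sch_scaleE) !mxE !inord6_eq //=; ring.
Qed.

Lemma borel_charE (x : borel K) : borel_char lambda x =
  vsval x 0 (inord 1) * weight_h + vsval x 0 (inord 5) * weight_z.
Proof.
set x1 := vsval x 0 _; set x5 := vsval x 0 _.
have hC : sch_h K \in cartan_space K.
  by apply/in_cartan; exists 1, 0; rewrite scale1r scale0r addr0.
have zC : sch_z K \in cartan_space K.
  by apply/in_cartan; exists 0, 1; rewrite scale1r scale0r add0r.
pose c : cartan K := x1 *: vsproj (cartan_space K) (sch_h K)
  + x5 *: vsproj (cartan_space K) (sch_z K).
have cE : vsval c = x1 *: sch_h K + x5 *: sch_z K by rewrite linearP linearZ /= !vsprojK.
have cB : vsval c \in borel_space K by apply: subvP (addvSl _ _) _ _; apply: subvsP.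
pose cb : borel K := vsproj (borel_space K) (vsval c).
have cbE : vsval cb = vsval c by apply: vsprojK.
(* [cb] is the part of [x] along h and z; the rest lies in n_+, where the character vanishes. *)
have -> : x = cb + (x - cb) by rewrite addrC subrK.
rewrite linearD /= (borel_char_cartan lambda cbE) [X in _ + X]borel_char_nplus.
  by rewrite addr0 linearP linearZ.
rewrite linearB /= cbE cE; have [x2 x4] := borel_coord (subvsP x).
apply/in_nplus; exists (vsval x 0 (inord 0)), (vsval x 0 (inord 3)).
rewrite [X in X - _]sch_basis x2 x4 -/x1 -/x5 !scale0r !addr0.
by rewrite opprD (AC (4*2) (1*3*(2*5)*(4*6))) /= !subrr !addr0.
Qed.

(** The vector 1 (x) c, a multiple of the highest weight vector. *)
Definition verma_gen (c : K) : Verma lambda :=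
  tpi (Uborel_map K) (TTen 1 (c : one_dim_module lambda)).

Lemma verma_gen_borel (s : enveloping (borel K)) c :
  Uborel_map K s *: verma_gen c = verma_gen (Uborel_char lambda s * c).
Proof.
rewrite /verma_gen [LHS]tscaleE /= mulr1 -[Uborel_map K s]mul1r.
exact/tpi_eq/teq_tenS.
Qed.

Lemma verma_gen_sch (x : S) c : x \in borel_space K -> ugen x *: verma_gen c =
  verma_gen ((x 0 (inord 1) * weight_h + x 0 (inord 5) * weight_z) * c).
Proof.
move=> xb; pose y : borel K := vsproj (borel_space K) x.
have yE : vsval y = x by apply: vsprojK.
have mapE : Uborel_map K (ugen y) = ugen (vsval y) by apply: ulift_gen.
have charE : Uborel_char lambda (ugen y) = borel_char lambda y by apply: ulift_gen.
by rewrite -[x in LHS]yE -mapE verma_gen_borel charE borel_charE yE.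
Qed.

Lemma verma_genD c d : verma_gen (c + d) = verma_gen c + verma_gen d.
Proof. by rewrite /verma_gen [RHS]taddE; apply/tpi_eq/teq_tenDr. Qed.

Lemma verma_gen0 : verma_gen 0 = 0.
Proof. by apply: (addrI (verma_gen 0)); rewrite -verma_genD !addr0. Qed.

(** The module is spanned by the vectors u (1 (x) c), and a central element can be moved past u. *)
Lemma verma_generated (x : U) : (forall u, u * x = x * u) ->
  (forall c, x *: verma_gen c = 0) -> annihilator (Verma lambda) x.
Proof.
move=> xC x0 m; rewrite -[m]treprK; elim: (trepr m) => [u n||t IH|t IH t' IH'].
- have -> : tpi (Uborel_map K) (TTen u n) = u *: verma_gen n.
    by rewrite /verma_gen [RHS]tscaleE /= mulr1.
  by rewrite scalerA -xC -scalerA x0 scaler0.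
- exact: scaler0.
- by rewrite -toppE [X in x *: X](_ : _ = - tpi _ t) // scalerN IH oppr0.
- rewrite -taddE [X in x *: X](_ : _ = tpi _ t + tpi _ t') // scalerDr.
  by rewrite IH IH' addr0.
Qed.

End VermaModule.

(** * Generators, relations and central elements of the enveloping algebra *)

Lemma upi_cst (K : fieldType) (L : lieAlgType K) (k : K) :
  upi (UCst L k) = k%:A.
Proof.
rewrite /GRing.scale /GRing.one /= uscaleE.
exact/upi_eq/ueq_sym/ueq_mul1r.
Qed.

Lemma enveloping_ind (K : fieldType) (L : lieAlgType K)
    (P : enveloping L -> Prop) :
  P 1 -> (forall u v, P u -> P v -> P (u + v)) -> (forall k u, P u -> P (k *: u)) ->
  (forall x u, P u -> P (ugen x * u)) -> forall u, P u.
Proof.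
move=> P1 PD PZ Pg u; rewrite -[u]mulr1 -[u]ureprK.
(* With 1 generalized to any [w] satisfying [P], a product acts as two successive left
   multiplications. *)
elim: (urepr u) 1 P1 => [x|k|t IH t' IH'|t IH t' IH'] w Pw.
- exact: Pg.
- by rewrite upi_cst mulr_algl; apply: PZ.
- have -> : upi (UAdd t t') = upi t + upi t' by rewrite [RHS]uaddE.
  by rewrite mulrDl; apply: PD; [apply: IH|apply: IH'].
- have -> : upi (UMul t t') = upi t * upi t' by rewrite [RHS]umulE.
  by rewrite -mulrA; apply/IH/IH'.
Qed.

Section SchroedingerEnveloping.
Variable K : fieldType.
Let S := schroedinger K.
Let U := enveloping S.

Definition Ue : U := ugen (sch_e K).
Definition Uh : U := ugen (sch_h K).
Definition Uf : U := ugen (sch_f K).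
Definition Up : U := ugen (sch_p K).
Definition Uq : U := ugen (sch_q K).
Definition Uz : U := ugen (sch_z K).

Lemma sch_enveloping_ind (P : U -> Prop) :
  P 1 -> (forall u v, P u -> P v -> P (u + v)) -> (forall k u, P u -> P (k *: u)) ->
  (forall u, P u -> [/\ P (Ue * u), P (Uh * u) & P (Uf * u)]) ->
  (forall u, P u -> [/\ P (Up * u), P (Uq * u) & P (Uz * u)]) -> forall u, P u.
Proof.
move=> P1 PD PZ Psl Pheis; apply: enveloping_ind => // x u Pu.
have [Pe Ph Pf] := Psl _ Pu; have [Pp Pq Pz] := Pheis _ Pu.
rewrite (sch_basis x) !linearD !linearZ /= !mulrDl -!scalerAl.
by do 5 (apply: (PD); last exact: (PZ)); apply: PZ.
Qed.

Let bracket_rel (x y w : S) : lie x y = w -> ugen x * ugen y = ugen y * ugen x + ugen w.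
Proof. by move=> <-; rewrite ugen_lie addrC subrK. Qed.

Lemma Urels : [/\ Ue * Uf = Uf * Ue + Uh, Uh * Uf = Uf * Uh - Uf *+ 2,
  Uh * Ue = Ue * Uh + Ue *+ 2, Up * Uf = Uf * Up - Uq & Uq * Uf = Uf * Uq]
  /\ [/\ Up * Uq = Uq * Up + Uz, Ue * Uq = Uq * Ue + Up, Uh * Uq = Uq * Uh - Uq,
  Ue * Up = Up * Ue & Uh * Up = Up * Uh + Up].
Proof.
have [[he ef hf eq_q ep] [hp fp fq hq pq] _] := sch_brackets K.
split; split.
- exact: bracket_rel ef.
- by rewrite (bracket_rel hf) linearN linearZ /= scaler_nat.
- by rewrite (bracket_rel he) linearZ /= scaler_nat.
- by rewrite [Uf * Up](bracket_rel fp) addrK.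
- by rewrite [Uf * Uq](bracket_rel fq) linear0 addr0.
- exact: bracket_rel pq.
- exact: bracket_rel eq_q.
- by rewrite (bracket_rel hq) linearN.
- by rewrite (bracket_rel ep) linear0 addr0.
- exact: bracket_rel hp.
Qed.

(** e, f and q generate the algebra: h = [e, f], p = [e, q] and z = [p, q]. *)
Lemma central_criterion (x : U) : Uq * x = x * Uq -> Uf * x = x * Uf ->
  Ue * x = x * Ue -> forall u, u * x = x * u.
Proof.
move=> qx fx ex.
have [[ef _ _ _ _] [pq eq_q _ _ _]] := Urels.
have commM (u v : U) : u * x = x * u -> v * x = x * v -> u * v * x = x * (u * v).
  by move=> ux vx; rewrite -mulrA vx mulrA ux mulrA.
have commB (u v : U) : u * x = x * u -> v * x = x * v -> (u - v) * x = x * (u - v).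
  by move=> ux vx; rewrite mulrBl mulrBr ux vx.
have hx : Uh * x = x * Uh.
  have -> : Uh = Ue * Uf - Uf * Ue by rewrite ef addrC addKr.
  by apply: commB; apply: commM.
have px : Up * x = x * Up.
  have -> : Up = Ue * Uq - Uq * Ue by rewrite eq_q addrC addKr.
  by apply: commB; apply: commM.
have zx : Uz * x = x * Uz.
  have -> : Uz = Up * Uq - Uq * Up by rewrite pq addrC addKr.
  by apply: commB; apply: commM.
apply: sch_enveloping_ind.
- by rewrite mul1r mulr1.
- by move=> u v ux vx; rewrite mulrDl mulrDr ux vx.
- by move=> k u ux; rewrite -scalerAl -scalerAr ux.
- by move=> u ux; split; apply: commM.
- by move=> u ux; split; apply: commM.
Qed.

Lemma Uz_central u : u * Uz = Uz * u.
Proof.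
have [_ _ zx] := sch_brackets K.
by apply: central_criterion; rewrite [RHS](bracket_rel (zx _)) linear0 addr0.
Qed.

Definition Ucasimir : U := casimir Ue Uf Uh Up Uq Uz.

Lemma Ucasimir_central u : u * Ucasimir = Ucasimir * u.
Proof.
have [[ef hf he pf qf] [pq eq_q hq ep hp]] := Urels.
have [[qc fc] ec] := casimir_commutes ef hf he pf qf pq eq_q hq ep hp Uz_central.
exact: central_criterion qc fc ec _.
Qed.

Variable lambda : {linear cartan K -> K^o}.
Let a := weight_h lambda.
Let b := weight_z lambda.
(** On the highest weight vector all terms of [casimir] with e or p vanish, which leaves z (h^2 + 3
    h). *)
Let chi := b * (a * a + a *+ 3).

Lemma verma_gen_actions c :
  [/\ Ue *: verma_gen lambda c = 0, Up *: verma_gen lambda c = 0,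
      Uh *: verma_gen lambda c = verma_gen lambda (a * c) &
      Uz *: verma_gen lambda c = verma_gen lambda (b * c)].
Proof.
have cart x : x \in cartan_space K -> x \in borel_space K.
  exact: (subvP (addvSl _ _)).
have npl x : x \in nplus_space K -> x \in borel_space K.
  exact: (subvP (addvSr _ _)).
have eB : sch_e K \in borel_space K.
  by apply/npl/in_nplus; exists 1, 0; rewrite scale1r scale0r addr0.
have pB : sch_p K \in borel_space K.
  by apply/npl/in_nplus; exists 0, 1; rewrite scale1r scale0r add0r.
have hB : sch_h K \in borel_space K.
  by apply/cart/in_cartan; exists 1, 0; rewrite scale1r scale0r addr0.
have zB : sch_z K \in borel_space K.
  by apply/cart/in_cartan; exists 0, 1; rewrite scale1r scale0r add0r.
split; rewrite verma_gen_sch // /sch_e /sch_h /sch_p /sch_z !mxE !inord6_eq //=.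
- by rewrite !mul0r addr0 mul0r verma_gen0.
- by rewrite !mul0r addr0 mul0r verma_gen0.
- by rewrite mul1r mul0r addr0.
- by rewrite mul1r mul0r add0r.
Qed.

Lemma scalar_verma_gen (k : K) c :
  k%:A *: verma_gen lambda c = verma_gen lambda (k * c).
Proof.
have <- : Uborel_map K k%:A = k%:A by rewrite [LHS]linearZ /= rmorph1.
by rewrite verma_gen_borel [Uborel_char _ _]linearZ /= rmorph1 [k *: _]mulr1.
Qed.

Lemma Uz_ann : annihilator (Verma lambda) (Uz - b%:A).
Proof.
apply: verma_generated => [u|c].
  by rewrite mulrBr mulrBl Uz_central mulr_algl mulr_algr.
by have [_ _ _ zc] := verma_gen_actions c; rewrite scalerBl zc scalar_verma_gen subrr.
Qed.

Lemma Ucasimir_ann : annihilator (Verma lambda) (Ucasimir - chi%:A).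
Proof.
apply: verma_generated => [u|c].
  by rewrite mulrBr mulrBl Ucasimir_central mulr_algl mulr_algr.
have act c' := verma_gen_actions c'.
have ec c' : Ue *: verma_gen lambda c' = 0 by have [] := act c'.
have pc c' : Up *: verma_gen lambda c' = 0 by have [] := act c'.
have hc c' : Uh *: verma_gen lambda c' = verma_gen lambda (a * c') by have [] := act c'.
have zc c' : Uz *: verma_gen lambda c' = verma_gen lambda (b * c') by have [] := act c'.
rewrite scalerBl scalar_verma_gen /Ucasimir /casimir.
rewrite !(scalerDl, scaleNr, mulrDr, mulrnAr) !mulr1.
rewrite -!scalerA !(ec, pc, hc, zc, verma_gen0, scaler0) ?addr0 subr0 -!verma_genD.
by apply/eqP; rewrite subr_eq0; apply/eqP; congr verma_gen; rewrite /chi; ring.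
Qed.
End SchroedingerEnveloping.

(** * The vector v_(0, 0) and the basis of the Lie algebra acting on functions *)

Definition delta (R : nzRingType) : int -> int -> R :=
  fun r s => ((r == 0) && (s == 0))%:R.

Lemma delta0 (R : nzRingType) (k : R) r s :
  (r = 0 -> s = 0 -> k = 0) -> k * delta R r s = 0.
Proof.
rewrite /delta; have [->|_] := eqVneq r 0; last by rewrite mulr0.
by have [->|_] := eqVneq s 0 => [/(_ erefl erefl) ->|_]; rewrite ?mul0r ?mulr0.
Qed.

Section Basis.
Variables (K : fieldType) (R : comNzRingType) (iota : {rmorphism K -> R}).
Variables (a beta : K) (I J : R).
Let gen := shift_gen iota a beta I J.

Lemma shift_gen_basis :
  [/\ gen (sch_e K) = shift_e iota a beta I J, gen (sch_h K) = shift_h iota a I J,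
      gen (sch_f K) = @shift_f R & gen (sch_p K) = shift_p iota beta I J]
  /\ gen (sch_q K) = @shift_q R.
Proof.
rewrite /gen /shift_gen /sch_e /sch_h /sch_f /sch_p /sch_q.
split; first split.
all: apply/funext => phi; apply/funext => r; apply/funext => s.
all: by rewrite !mxE !inord6_eq //= !(rmorph0, rmorph1) !(mul0r, mul1r, add0r, addr0).
Qed.

Lemma shift_gen_e : gen (sch_e K) = shift_e iota a beta I J.
Proof. by have [[]] := shift_gen_basis. Qed.
Lemma shift_gen_h : gen (sch_h K) = shift_h iota a I J.
Proof. by have [[]] := shift_gen_basis. Qed.
Lemma shift_gen_f : gen (sch_f K) = @shift_f R.
Proof. by have [[]] := shift_gen_basis. Qed.
Lemma shift_gen_p : gen (sch_p K) = shift_p iota beta I J.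
Proof. by have [[]] := shift_gen_basis. Qed.
Lemma shift_gen_q : gen (sch_q K) = @shift_q R.
Proof. by have [[]] := shift_gen_basis. Qed.
End Basis.

(** * Specialization of the generic vector *)

Section Specialization.
Variables (K : fieldType) (R R' : comNzRingType).
Variables (iota : {rmorphism K -> R}) (iota' : {rmorphism K -> R'}).
Variables (ev : {rmorphism R -> R'}) (a beta : K) (I J : R) (I' J' : R') (n m : int).
Hypotheses (ev_iota : forall k, ev (iota k) = iota' k)
  (evI : ev I = I' + n%:~R) (evJ : ev J = J' + m%:~R).

(* Besides specializing (I, J) to (I' + n, J' + m), this renames v_(r, s) to
   v_(r + n, s + m), so that both sides refer to the same exponents. *)
Definition specialize (phi : int -> int -> R) : int -> int -> R' :=
  fun r s => ev (phi (r - n) (s - m)).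

(** The operators depend on r and s only through I + r and J + s, and these match: I' + n + (r - n)
    = I' + r. *)
Lemma specialize_act u phi : specialize (shift_act iota a beta I J u phi) =
  shift_act iota' a beta I' J' u (specialize phi).
Proof.
rewrite /shift_act; elim: (urepr u) phi => [x|k|t IH t' IH'|t IH t' IH'] phi /=.
- apply/funext => r; apply/funext => s.
  rewrite /specialize /shift_gen /shift_e /shift_h /shift_f /shift_p /shift_q.
  rewrite !(rmorphD ev, rmorphN ev, rmorphM ev, rmorph_nat ev, rmorph1 ev) !ev_iota.
  rewrite !rmorph_int evI evJ !intrB.
  rewrite !(addrAC _ (- n)) !(addrAC _ (- m)).
  by ring.
- by apply/funext => r; apply/funext => s; rewrite /specialize rmorphM /= ev_iota.
- rewrite -IH -IH'; apply/funext => r; apply/funext => s.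
  by rewrite /specialize rmorphD.
- by rewrite IH IH'.
Qed.
End Specialization.

(** * From the Verma module to functions *)

Section VermaShift.
Variables (K : fieldType) (lambda : {linear cartan K -> K^o}) (beta : K).
Hypothesis beta2 : weight_z lambda = 2 * beta.

Let S := schroedinger K.
Let U := enveloping S.
Let act := shift_act (idfun : {rmorphism K -> K}) (weight_h lambda) beta 0 0.

(** For I = J = 0, [delta] is a highest weight vector: the coefficients of e and p leading to a
    negative exponent have a factor that vanishes there. *)
Lemma shift_gen_borel (x : borel K) c :
  shift_gen idfun (weight_h lambda) beta 0 0 (vsval x) (fun r s => c * delta K r s)
  = fun r s => borel_char lambda x * c * delta K r s.
Proof.
have [x2 x4] := borel_coord (subvsP x).
apply/funext => r; apply/funext => s.
rewrite /shift_gen x2 x4 borel_charE beta2 /= !mul0r !addr0.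
have -> : shift_e idfun (weight_h lambda) beta 0 0 (fun r s => c * delta K r s) r s = 0.
  rewrite /shift_e !(mulrCA _ c) [X in c * X]delta0 => [|_ /eqP].
    rewrite [X in _ + c * X]delta0 ?addr0 => [|/eqP]; first by rewrite !mulr0 addr0.
    by rewrite addr_eq0 => /eqP -> _; rewrite mulrNz; ring.
  by rewrite addr_eq0 => /eqP ->; rewrite mulrNz; ring.
have -> : shift_p idfun beta 0 0 (fun r s => c * delta K r s) r s = 0.
  rewrite /shift_p !(mulrCA _ c) [X in c * X]delta0 => [|_ /eqP].
    rewrite [X in _ - c * X]delta0 ?addr0 => [|/eqP]; first by rewrite !mulr0 subr0.
    by rewrite addr_eq0 => /eqP -> _; rewrite mulrNz; ring.
  by rewrite addr_eq0 => /eqP ->; rewrite mulrNz; ring.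
rewrite /shift_h /delta; have [->|r0] := eqVneq r 0; have [->|s0] := eqVneq s 0;
  by rewrite /= ?mulr0z; ring.
Qed.

Lemma verma_act (s : enveloping (borel K)) c :
  act (Uborel_map K s) (fun r s => c * delta K r s)
  = fun r s' => Uborel_char lambda s * c * delta K r s'.
Proof.
elim/enveloping_ind: s c => [|u v IHu IHv|k u IH|x u IH] c.
- by rewrite rmorph1 [act _ _]shift_act1 rmorph1 mul1r.
- rewrite !rmorphD; apply/funext => r; apply/funext => s.
  by rewrite [LHS]shift_actD [X in X + _](congr1 (fun f => f r s) (IHu c))
    [X in _ + X](congr1 (fun f => f r s) (IHv c)) !mulrDl.
- apply/funext => r; apply/funext => s.
  rewrite [Uborel_map K _]linearZ [Uborel_char _ _]linearZ /=.
  by rewrite [LHS]shift_actZ [X in _ * X](congr1 (fun f => f r s) (IH c)) /= !mulrA.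
- rewrite !rmorphM [LHS]shift_actM [X in shift_act _ _ _ _ _ _ X]IH.
  have -> : Uborel_map K (ugen x) = ugen (vsval x) by apply: ulift_gen.
  have -> : Uborel_char lambda (ugen x) = borel_char lambda x by apply: ulift_gen.
  by rewrite shift_act_gen shift_gen_borel !mulrA.
Qed.

(** The map u (x) c to u (c delta) on representatives; [verma_act] is its compatibility with the
    right action of U(b). *)
Fixpoint verma_term (t : tterm U (one_dim_module lambda)) : int -> int -> K :=
  match t with
  | TTen u c => act u (fun r s => (c : K) * delta K r s)
  | TZero => fun _ _ => 0
  | TOpp t => fun r s => - verma_term t r s
  | TAdd t t' => fun r s => verma_term t r s + verma_term t' r s
  end.

Lemma verma_term_teq t t' : teq (Uborel_map K) t t' -> verma_term t = verma_term t'.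
Proof.
elim=> //=.
- by move=> ? ? ? _ -> _ ->.
- by move=> ? ? _ ->.
- by move=> ? ? ? ? _ -> _ ->.
- by move=> *; apply/funext => r; apply/funext => s; rewrite addrA.
- by move=> *; apply/funext => r; apply/funext => s; rewrite addrC.
- by move=> *; apply/funext => r; apply/funext => s; rewrite add0r.
- by move=> *; apply/funext => r; apply/funext => s; rewrite addNr.
- by move=> u v c; apply/funext => r; apply/funext => s; rewrite [LHS]shift_actD.
- move=> u c d; rewrite -[RHS]shift_termD; congr (act u _).
  by apply/funext => r; apply/funext => s; rewrite mulrDl.
- by move=> u s c; rewrite [LHS]shift_actM [X in shift_act _ _ _ _ _ _ X]verma_act.
Qed.

(** The vector x (u (x) 1) = x u (x) 1 is zero, and so is its image under [verma_term]. *)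
Lemma annihilator_shift x u : annihilator (Verma lambda) x ->
  act x (act u (delta K)) = fun _ _ => 0.
Proof.
move=> x0; have := x0 (tpi (Uborel_map K) (TTen u (1 : one_dim_module lambda))).
rewrite [_ *: _]tscaleE => /(@tpiP _ _ (Uborel_map K)) /verma_term_teq /=.
rewrite [act (x * u) _]shift_actM => <-; congr (act x (act u _)).
by apply/funext => r; apply/funext => s; rewrite mul1r.
Qed.

Lemma act_delta (n m : nat) :
  act (Uf K ^+ n * Uq K ^+ m) (delta K) = fun r s => delta K (r - n%:Z) (s - m%:Z).
Proof.
rewrite [LHS]shift_actM.
have -> : shift_act idfun (weight_h lambda) beta 0 0 (Uq K ^+ m) (delta K) =
    fun r s => delta K r (s - m%:Z).
  elim: m => [|m IH].
    by rewrite shift_act1; apply/funext => r; apply/funext => s; rewrite subr0.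
  rewrite exprS shift_actM IH /Uq shift_act_gen shift_gen_q.
  apply/funext => r; apply/funext => s.
  by rewrite /shift_q -addrA -opprD -intS.
elim: n => [|n IH].
  by rewrite shift_act1; apply/funext => r; apply/funext => s; rewrite subr0.
rewrite exprS shift_actM IH /Uf shift_act_gen shift_gen_f.
by apply/funext => r; apply/funext => s; rewrite /shift_f -addrA -opprD -intS.
Qed.
End VermaShift.

(** * Leading terms *)

Lemma poly_vanish (D : idomainType) (P : {poly D}) (g : nat -> D) :
  injective g -> (forall n, P.[g n] = 0) -> P = 0.
Proof.
move=> g_inj P0; apply/eqP; apply: contraT => Pn0.
have := @max_poly_roots _ P (map g (iota 0 (size P))) Pn0.
rewrite map_inj_uniq // iota_uniq size_map size_iota ltnn; apply=> //.
by apply/allP => _ /mapP[n _ ->]; apply/eqP.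
Qed.

Lemma seq_argmax (T : eqType) (g : T -> nat) (s : seq T) : s != [::] ->
  exists2 x, x \in s & forall y, y \in s -> (g y <= g x)%N.
Proof.
elim: s => // x [|y s] IH _.
  by exists x; rewrite ?mem_head // => y; rewrite inE => /eqP ->.
have [//|t ts tmax] := IH; have [xt|tx] := leqP (g x) (g t).
  exists t => [|v]; rewrite inE; first by rewrite ts orbT.
  by case/orP => [/eqP ->|/tmax].
exists x => [|v]; first exact: mem_head.
by rewrite inE => /orP[/eqP ->|/tmax vt] //; apply: leq_trans vt (ltnW tx).
Qed.

(** The keys will be the exponent of q and the degrees in I and H. Ties may remain; the exponent of
    f in the leading term resolves them, through [reduced_inj]. *)
Lemma seq_lexmax (T : eqType) (g g' g'' : T -> nat) (s : seq T) : s != [::] ->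
  exists2 x, x \in s & forall y, y \in s -> (g y < g x)%N \/
    g y = g x /\ ((g' y < g' x)%N \/ g' y = g' x /\ (g'' y <= g'' x)%N).
Proof.
move=> /(seq_argmax g)[x xs xmax].
have nil (P : pred T) (t : seq T) u : u \in t -> P u -> [seq v <- t | P v] != [::].
  by move=> ut Pu; rewrite -has_filter; apply/hasP; exists u.
have /(seq_argmax g')[y] := nil (fun v => g v == g x) s x xs (eqxx _).
rewrite mem_filter => /andP[/eqP yx ys] ymax.
have /(seq_argmax g'')[t] := nil (fun v => (g v == g x) && (g' v == g' y)) s y ys
  (introT andP (conj (introT eqP yx) (eqxx _))).
rewrite mem_filter => /andP[/andP[/eqP tx /eqP ty] ts] tmax.
exists t => // v vs; rewrite tx ty.
have := xmax v vs; rewrite leq_eqVlt => /orP[/eqP vx|]; last by left.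
right; split=> //.
have := ymax v; rewrite mem_filter vx eqxx vs leq_eqVlt.
move=> /(_ isT)/orP[/eqP vy|]; last by left.
by right; split=> //; apply: tmax; rewrite mem_filter vx vy !eqxx.
Qed.

Section LeadingTerm.
Variables (K : fieldType) (a beta : K).

Let R := {poly {poly K}}.
Let G := int -> int -> R.

Definition gen_const : {rmorphism K -> R} := polyC \o polyC.
Definition gen_I : R := 'X.
(* The inner variable is the weight a - 2 I - J of the generic vector, so that h
   acts on it as multiplication by ['X%:P]. *)
Definition gen_J : R := gen_const a - 'X%:P - 2 * 'X.

Let act := shift_act gen_const a beta gen_I gen_J.

(** The leading part is the row with the highest exponent of q; it is required to consist of a
    single vector v_(u, w). *)
Definition has_top (phi : G) (u w : int) (P : R) : Prop :=
  (forall r, phi r w = if r == u then P else 0) /\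
  (forall r s, w < s -> phi r s = 0).

Lemma top_f phi u w P : has_top phi u w P -> has_top (shift_f phi) (u + 1) w P.
Proof.
case=> phiw phi0; split=> [r|r s ws]; rewrite /shift_f ?phiw ?phi0 //.
by rewrite subr_eq.
Qed.

Lemma top_q phi u w P : has_top phi u w P -> has_top (shift_q phi) u (w + 1) P.
Proof.
case=> phiw phi0; split=> [r|r s ws]; rewrite /shift_q ?addrK ?phiw //.
by rewrite phi0 // ltrBrDr.
Qed.

(** The term with [beta] lowers the exponent of q while the other raises it, so only the latter
    reaches the new top row. *)
Lemma top_p phi u w P : has_top phi u w P ->
  has_top (shift_p gen_const beta gen_I gen_J phi) (u - 1) (w + 1)
    (- (gen_I + u%:~R) * P).
Proof.
case=> phiw phi0; split=> [r|r s ws]; rewrite /shift_p.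
  rewrite addrK phiw phi0; last by lia.
  rewrite mulr0 add0r -[r == _](inj_eq (addIr 1)) subrK.
  have [<-|_] := eqVneq (r + 1) u; last by rewrite mulr0 oppr0.
  by rewrite intrD addrA mulNr.
by rewrite !phi0 ?mulr0 ?subr0 //; lia.
Qed.

(** The term with [beta] lowers the exponent of q by two. In the other, a - J = H + 2 I, with H for
    ['X%:P], turns a - (J + w) - (I + u - 1) into H + I + 1 - u - w, which is monic in I. *)
Lemma top_e phi u w P : has_top phi u w P ->
  has_top (shift_e gen_const a beta gen_I gen_J phi) (u - 1) w
   ((gen_I + u%:~R) * ('X%:P + gen_I + (1 - u - w)%:~R) * P).
Proof.
case=> phiw phi0; split=> [r|r s ws]; rewrite /shift_e.
  rewrite phiw phi0; last by lia.
  rewrite mulr0 add0r -[r == _](inj_eq (addIr 1)) subrK.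
  have [<-|_] := eqVneq (r + 1) u; last by rewrite mulr0.
  by rewrite /gen_J /gen_I !(intrD, mulrNz); ring.
by rewrite !phi0 ?mulr0 ?addr0 //; lia.
Qed.

(** [A] is monic in I over K[H], so the top coefficient in I is H^k up to sign and reveals k. The
    signs come from [p]. *)
Definition lead_form (n k : nat) (P : R) : Prop :=
  exists b : bool, exists2 A : R, (A \is monic) && (size A == n.+1) &
    P = (-1) ^+ b * A * ('X^k)%:P.

Lemma lead_formMl n k (C : {poly K}) P :
  lead_form n k P -> lead_form n.+1 k (('X + C%:P) * P).
Proof.
case=> b [A /andP[mA /eqP sA] ->]; exists b, (('X + C%:P) * A); last by ring.
have -> : 'X + C%:P = 'X - (- C)%:P by rewrite polyCN opprK.
rewrite monicMl ?monicXsubC // mA size_monicM ?monicXsubC ?monic_neq0 //.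
by rewrite size_XsubC sA /= addSn eqxx.
Qed.

Lemma lead_formN n k P : lead_form n k P -> lead_form n k (- P).
Proof.
case=> b [A mA ->]; exists (~~ b), A => //.
by case: b; rewrite /= ?expr0 ?expr1; ring.
Qed.

Lemma lead_form_coef n k P : lead_form n k P ->
  exists b : bool, P`_n = (-1) ^+ b * 'X^k /\ forall n', (n < n')%N -> P`_n' = 0.
Proof.
case=> b [A /andP[mA /eqP sA] ->]; exists b.
have sgn : (-1) ^+ b = ((-1) ^+ b)%:P :> R by rewrite polyC_exp polyCN.
rewrite sgn; split=> [|n' nn']; rewrite coefMC coefCM.
  by move/monicP: mA; rewrite lead_coefE sA /= => ->; rewrite mulr1.
by rewrite (nth_default _ (s := A)) ?sA // mulr0 mul0r.
Qed.

Let X (t : expo) := monom (Ue K) (Uf K) (Uh K) (Up K) (Uq K) t.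

(* [top_u] and [top_w] are the increments of the exponents of f and q in the
   leading term, [top_n] and [top_k] the degrees of its coefficient in I and H. *)
Definition top_u (t : expo) : int := let '(i, _, l, m, _) := t in i%:Z - l%:Z - m%:Z.
Definition top_w (t : expo) : nat := let '(_, j, l, _, _) := t in (j + l)%N.
Definition top_n (t : expo) : nat := let '(_, _, l, m, _) := t in (l + 2 * m)%N.
Definition top_k (t : expo) : nat := let '(_, _, _, _, k) := t in k.

(** From the right: h^k multiplies [delta] by H^k, each e contributes two factors monic and linear
    in I, each p one such factor and a sign, and q and f only shift indices. *)
Lemma monom_top t : exists2 P, has_top (act (X t) (delta R)) (top_u t) (top_w t)%:Z P &
  lead_form (top_n t) (top_k t) P.
Proof.
case: t => [[[[i j] l] m] k]; rewrite /X /monom /=.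
have hk : act (Uh K ^+ k) (delta R) = fun r s => ('X^k)%:P * delta R r s.
  elim: k => [|k IH].
    rewrite [LHS]shift_act1; apply/funext => r; apply/funext => s.
    by rewrite expr0 polyC1 mul1r.
  rewrite exprS [LHS]shift_actM [X in shift_act _ _ _ _ _ _ X]IH.
  rewrite /Uh shift_act_gen shift_gen_h.
  apply/funext => r; apply/funext => s; rewrite /shift_h /delta /gen_I /gen_J.
  have [->|r0] := eqVneq r 0; have [->|s0] := eqVneq s 0; rewrite /= ?mulr0 //.
  by rewrite !mulr0z exprS rmorphM /=; ring.
have [P0 t0 l0] : exists2 P, has_top (act (Uh K ^+ k) (delta R)) 0 0 P & lead_form 0 k P.
  exists ('X^k)%:P; last first.
    by exists false, 1; rewrite ?monic1 ?size_poly1 // expr0 !mul1r.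
  rewrite hk /delta; split=> [r|r s s0]; last by rewrite (gt_eqF s0) andbF mulr0.
  by have [_|_] := eqVneq r 0; rewrite /= ?mulr1 ?mulr0.
have [P1 t1 l1] : exists2 P, has_top (act (Ue K ^+ m * Uh K ^+ k) (delta R)) (- m%:Z) 0 P
    & lead_form (2 * m) k P.
  elim: m {i j l} => [|m [P tP lP]]; first by exists P0; rewrite ?expr0 ?mul1r.
  exists ((gen_I + (- m%:Z)%:~R) * ('X%:P + gen_I + (1 - - m%:Z - 0)%:~R) * P).
    rewrite exprS -mulrA [act _ _]shift_actM /Ue shift_act_gen shift_gen_e.
    by rewrite (_ : - m.+1%:Z = - m%:Z - 1) //; [apply: top_e|lia].
  rewrite mulnS !addSn add0n -mulrA.
  have -> : gen_I + (- m%:Z)%:~R = 'X + ((- m%:Z)%:~R)%:P by rewrite rmorph_int.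
  apply: lead_formMl.
  have -> : 'X%:P + gen_I + (1 - - m%:Z - 0)%:~R = 'X + ('X + (1 - - m%:Z - 0)%:~R)%:P.
    by rewrite polyCD [(_%:~R)%:P](rmorph_int polyC) /gen_I addrA (addrC 'X).
  exact: lead_formMl.
have [P2 t2 l2] : exists2 P, has_top (act (Up K ^+ l * (Ue K ^+ m * Uh K ^+ k)) (delta R))
    (- l%:Z - m%:Z) l P & lead_form (l + 2 * m) k P.
  elim: l {i j} => [|l [P tP lP]].
    by exists P1; rewrite ?expr0 ?mul1r // oppr0 add0r.
  exists (- (gen_I + (- l%:Z - m%:Z)%:~R) * P).
    rewrite exprS -mulrA [act _ _]shift_actM /Up shift_act_gen shift_gen_p.
    rewrite (_ : - l.+1%:Z - m%:Z = - l%:Z - m%:Z - 1); last by lia.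
    by rewrite (_ : l.+1%:Z = l%:Z + 1); [apply: top_p|lia].
  have -> : gen_I + (- l%:Z - m%:Z)%:~R = 'X + ((- l%:Z - m%:Z)%:~R)%:P.
    by rewrite rmorph_int.
  by rewrite addSn mulNr; apply/lead_formN/lead_formMl.
exists P2 => //; rewrite -!mulrA [act _ _]shift_actM.
have t3 : has_top (act (Uq K ^+ j * (Up K ^+ l * (Ue K ^+ m * Uh K ^+ k))) (delta R))
    (- l%:Z - m%:Z) (j + l)%N P2.
  elim: j => [|j IH]; first by rewrite expr0 mul1r.
  rewrite exprS -mulrA [act _ _]shift_actM /Uq shift_act_gen shift_gen_q.
  by rewrite (_ : (j.+1 + l)%N%:Z = (j + l)%N%:Z + 1); [apply: top_q|lia].
elim: i => [|i IH]; first by rewrite expr0 shift_act1 sub0r.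
rewrite exprS [shift_act _ _ _ _ _ _ _]shift_actM /Uf shift_act_gen shift_gen_f.
by rewrite (_ : i.+1%:Z - l%:Z - m%:Z = i%:Z - l%:Z - m%:Z + 1); [apply: top_f|lia].
Qed.

End LeadingTerm.

(** If l' > l, equality of [top_n] gives l' - l = 2 (m - m') >= 2, and then equality of [top_u]
    gives i' = i + (l' - l) / 2 > 0, so t' is not reduced; the case l > l' is symmetric. *)
Lemma reduced_inj t t' : reduced t -> reduced t' -> top_u t = top_u t' ->
  top_w t = top_w t' -> top_n t = top_n t' -> top_k t = top_k t' -> t = t'.
Proof.
case: t => [[[[i j] l] m] k]; case: t' => [[[[i' j'] l'] m'] k'] /=.
move=> r r' eu ew en ek.
have [em el] : m = m' /\ l = l' by lia.
by do 4 (congr pair; last by lia); lia.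
Qed.

(** A list of terms may repeat an exponent; repetitions are merged before leading terms are
    compared. *)
Lemma big_collect (K : fieldType) (V : lmodType K) (T : eqType) (F : T -> V)
    (s : seq (K * T)) :
  \sum_(x <- s) x.1 *: F x.2 =
  \sum_(t <- undup [seq x.2 | x <- s]) (\sum_(x <- s | x.2 == t) x.1) *: F t.
Proof.
under [RHS]eq_bigr do rewrite scaler_suml big_mkcond.
rewrite exchange_big /= [LHS]big_seq [RHS]big_seq; apply: eq_bigr => x xs.
rewrite (bigD1_seq x.2) ?undup_uniq ?mem_undup ?map_f //= eqxx big1 ?addr0 // => t tx.
by rewrite eq_sym (negbTE tx).
Qed.

(** * Independence of the reduced monomials on the generic vector *)

Section Generic.
Variables (K : fieldType) (lambda : {linear cartan K -> K^o}) (beta : K).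
Hypothesis K0 : [pchar K] =i pred0.
Hypothesis beta2 : weight_z lambda = 2 * beta.

Let a := weight_h lambda.
Let R := {poly {poly K}}.
Let act := shift_act (gen_const K) a beta (gen_I K) (gen_J a).
Let X (t : expo) := monom (Ue K) (Uf K) (Uh K) (Up K) (Uq K) t.

Lemma natr_inj : injective (fun n : nat => n%:R : K).
Proof.
move=> n m /= nm; wlog le : n m nm / (n <= m)%N.
  by move=> H; have [/H|/ltnW/H] := leqP n m; [apply|move=> ->].
apply/eqP; rewrite eqn_leq le /= -subn_eq0 -((pcharf0P K).1 K0) natrB //.
by rewrite nm subrr.
Qed.

(** At natural numbers (n, m) the generic vector becomes f^n q^m v, which x kills; in characteristic
    0 this forces the polynomial coefficients to vanish. *)
Lemma annihilator_generic x : annihilator (Verma lambda) x ->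
  act x (delta R) = fun _ _ => 0.
Proof.
move=> x0; apply/funext => r; apply/funext => s.
have ev0 (n m : nat) : (act x (delta R) r s).[n%:R].[a - m%:R - 2 * n%:R] = 0.
  (* As J = a - H - 2 I, sending (I, J) to (n, m) means evaluating H at a - m - 2 n. *)
  pose ev : {rmorphism R -> K} :=
    horner_eval (a - m%:R - 2 * n%:R) \o horner_eval n%:R.
  have evi k : ev (gen_const K k) = k by rewrite /= /horner_eval !hornerC.
  have evI : ev (gen_I K) = 0 + n%:Z%:~R.
    by rewrite /= /horner_eval hornerX -[n%:R]polyC_natr hornerC add0r.
  have evJ : ev (gen_J a) = 0 + m%:Z%:~R.
    rewrite /gen_J !rmorphB rmorphM evi rmorph_nat [ev 'X]evI add0r.
    have -> : ev 'X%:P = a - m%:R - 2 * n%:R.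
      by rewrite /= /horner_eval hornerC hornerX.
    by rewrite !pmulrn; ring.
  have ed : specialize ev n%:Z m%:Z (delta R) =
      shift_act idfun a beta 0 0 (Uf K ^+ n * Uq K ^+ m) (delta K).
    rewrite act_delta; apply/funext => r'; apply/funext => s'.
    by rewrite /specialize /delta rmorph_nat.
  have := specialize_act (iota' := idfun) a beta evi evI evJ x (delta R).
  rewrite ed (annihilator_shift beta2 _ x0).
  move/(congr1 (fun f => f (r + n%:Z) (s + m%:Z))).
  by rewrite /specialize !addrK.
(* First all n are roots in I over K[H]; then, for fixed n, the values a - m - 2 n are infinitely
   many roots in H. *)
apply: (@poly_vanish _ _ (fun n => n%:R)) => [n m /= nm|n].
  apply: natr_inj; have := congr1 (fun P : {poly K} => P.[0]) nm.
  by rewrite -!polyC_natr !hornerC.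
apply: (@poly_vanish _ _ (fun m => a - m%:R - 2 * n%:R)) => [m m' /=|m].
  by move/addIr/addrI/oppr_inj => /natr_inj.
exact: ev0.
Qed.

(** A smaller key gives a zero coefficient by leading terms alone; if all three keys agree,
    [reduced_inj] makes the values of [top_u] differ. *)
Lemma monom_lead t t' : reduced t -> reduced t' -> t <> t' ->
  (top_w t < top_w t')%N \/ top_w t = top_w t' /\
  ((top_n t < top_n t')%N \/ top_n t = top_n t' /\ (top_k t <= top_k t')%N) ->
  (act (X t) (delta R) (top_u t') (top_w t')%:Z)`_(top_n t')`_(top_k t') = 0.
Proof.
move=> rt rt' tt' lex.
have [P [topP top0] /lead_form_coef[b [Pn P0]]] := monom_top a beta t.
case: lex => [ww|[ww lex]]; first by rewrite [act _ _ _ _]top0 ?coef0.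
rewrite -ww [act _ _ _ _]topP; have [uu|_] := eqVneq; last by rewrite !coef0.
case: lex => [nn|[nn kk]]; first by rewrite P0 ?coef0.
rewrite -nn Pn -(rmorph_sign (@polyC K)) coefCM coefXn.
have [ek|_] := eqVneq; last by rewrite mulr0.
by case: tt'; apply: reduced_inj.
Qed.

Lemma monom_lead_self t :
  (act (X t) (delta R) (top_u t) (top_w t)%:Z)`_(top_n t)`_(top_k t) != 0.
Proof.
have [P [topP _] /lead_form_coef[b [Pn _]]] := monom_top a beta t.
rewrite [act _ _ _ _]topP eqxx Pn -(rmorph_sign (@polyC K)) coefCM coefXn eqxx mulr1.
by rewrite signr_eq0.
Qed.

(** At the leading place of a maximal term with nonzero coefficient all other terms vanish, so the
    sum cannot act by zero there. *)
Lemma monom_free (s : seq (K * expo)) : all (fun x => reduced x.2) s ->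
  annihilator (Verma lambda) (\sum_(x <- s) x.1 *: X x.2) ->
  \sum_(x <- s) x.1 *: X x.2 = 0.
Proof.
move=> rs /annihilator_generic; rewrite big_collect.
set T := undup _; pose c (t : expo) := \sum_(x <- s | x.2 == t) x.1.
change (act (\sum_(t <- T) c t *: X t) (delta R) = (fun _ _ => 0) ->
  \sum_(t <- T) c t *: X t = 0) => act0.
have rT t : t \in T -> reduced t.
  by rewrite mem_undup => /mapP[x xs ->]; apply: (allP rs).
have [nil|/seq_lexmax] := eqVneq [seq t <- T | c t != 0] [::].
  rewrite big_seq big1 // => t tT; have [->|ct] := eqVneq (c t) 0.
    exact: scale0r.
  by have := mem_filter (fun t => c t != 0) t T; rewrite nil ct tT.
move=> /(_ top_w top_n top_k)[t]; rewrite mem_filter => /andP[ct tT] tmax.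
have actE r s' : act (\sum_(t <- T) c t *: X t) (delta R) r s'
    = \sum_(t <- T) gen_const K (c t) * act (X t) (delta R) r s'.
  elim: (T) => [|t' T' IH]; last first.
    by rewrite !big_cons [LHS]shift_actD shift_actZ; congr (_ + _); apply: IH.
  by rewrite !big_nil -(scale0r 0) [LHS]shift_actZ rmorph0 mul0r.
have := congr1 (fun f : int -> int -> R =>
  (f (top_u t) (top_w t)%:Z)`_(top_n t)`_(top_k t)) act0.
rewrite [act _ _ _ _]actE !coef_sum (bigD1_seq t) ?undup_uniq //= !coefCM.
rewrite big_seq_cond big1.
  rewrite addr0 !coef0 => /eqP; rewrite mulf_eq0 (negbTE ct).
  by rewrite (negbTE (monom_lead_self t)).
move=> t' /andP[t'T /eqP tt']; rewrite !coefCM.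
have [->|ct'] := eqVneq (c t') 0; first by rewrite mul0r.
rewrite monom_lead ?mulr0 //; try exact: rT.
by apply: tmax; rewrite mem_filter ct'.
Qed.

End Generic.

(** * Central generation of the annihilator *)

Section Main.
Variables (K : fieldType) (lambda : {linear cartan K -> K^o}).
Hypothesis K0 : [pchar K] =i pred0.

Let a := weight_h lambda.
Let b := weight_z lambda.
Let chi := b * (a * a + a *+ 3).

(** Modulo the ideal, x is a combination of reduced monomials. The ideal kills the module, so this
    combination does too, and it is zero by [monom_free]. *)
Lemma annihilator_central x : annihilator (Verma lambda) x ->
  central_ideal (Ue K) (Uf K) (Uh K) (Up K) (Uq K) (Uz K) b chi x.
Proof.
move=> x0.
have two_neq0 : 2%:R != 0 :> K by rewrite ((pcharf0P K).1 K0).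
have [[ef hf he pf qf] [pq eq_q hq ep hp]] := Urels K.
have cC := @Ucasimir_central K.
have zC := @Uz_central K.
pose W := in_span (Ue K) (Uf K) (Uh K) (Up K) (Uq K) (Uz K) b chi.
have Wx : W x.
  elim/sch_enveloping_ind: x {x0}.
  - exact: in_span1.
  - exact: in_spanD.
  - exact: in_spanZ.
  - move=> u Wu; split; [exact: in_spanMe|exact: in_spanMh|exact: in_spanMf].
  - move=> u Wu; split; [exact: in_spanMp|exact: in_spanMq|exact: in_spanMz].
have [s [rs Jx]] := Wx.
have Jann y : central_ideal (Ue K) (Uf K) (Uh K) (Up K) (Uq K) (Uz K) b chi y ->
    annihilator (Verma lambda) y.
  case=> u [v ->] m; rewrite scalerDl -(scalerA u) -(scalerA v).
  have -> : (Uz K - b%:A) *: m = 0 by apply: Uz_ann.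
  have -> : (casimir (Ue K) (Uf K) (Uh K) (Up K) (Uq K) (Uz K) - chi%:A) *: m = 0.
    exact: Ucasimir_ann.
  by rewrite !scaler0 addr0.
(* The shift module is parametrized by half of b, which exists because 2 is invertible. *)
have beta2 : weight_z lambda = 2 * (b / 2) by rewrite mulrC divfK.
move: (Jx); rewrite (monom_free K0 beta2 rs) ?subr0 // => m.
by rewrite -[X in X *: m](subKr x) scalerBl x0 [X in 0 - X]Jann // subr0.
Qed.

Lemma annihilator_verma : annihilator (Verma lambda) =
  left_ideal_gen (ring_center (enveloping (schroedinger K))
                  `&` annihilator (Verma lambda))%classic.
Proof.
apply/seteqP; split=> [x /annihilator_central[u [v ->]]|x [n [r [y [yA ->]]]] m].
  exists 2%N, (fun i => if i == 0 then u else v), (fun i =>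
    if i == 0 then Uz K - b%:A else Ucasimir K - chi%:A); split=> [i|].
    have [_|_] := eqVneq i 0; (split; [move=> w|]).
    - by rewrite mulrBl mulrBr Uz_central mulr_algl mulr_algr.
    - exact: Uz_ann.
    - by rewrite mulrBl mulrBr Ucasimir_central mulr_algl mulr_algr.
    - exact: Ucasimir_ann.
  by rewrite big_ord_recl big_ord1.
rewrite scaler_suml big1 // => i _.
by have [_ yi] := yA i; rewrite -scalerA yi scaler0.
Qed.

End Main.

Local Open Scope classical_set_scope.

Theorem theorem21 (R : realType) (lambda : {linear cartan R[i] -> R[i]^o}) :
  annihilator (Verma lambda) =
  left_ideal_gen (ring_center (enveloping (schroedinger R[i]))
                  `&` annihilator (Verma lambda)).
Proof. by apply: annihilator_verma; apply: pchar_num. Qed.
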